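(* Let $n\ge 2$ be an even integer, let $M=\mathbb{C}^n$ with standard linear coordinates $(z_1,\dots,z_n)$, let $X$ be the total space of the holomorphic tangent bundle $\mathcal{T}_M$ with projection $\pi\colon X\to M$, and let $(z_1,\dots,z_n,\theta_1,\dots,\theta_n)$ be the induced coordinates on $X$. Let $(\omega_{pq})$ be a constant non-degenerate skew-symmetric complex $n\times n$ matrix with inverse matrix $(\eta^{pq})$, and let $\omega=\sum_{p,q}\omega_{pq}\,dz^p\wedge dz^q$ be the corresponding holomorphic symplectic form on $M$. Let $X^0\subset X$ be an open subset and let $W\colon X^0\to\mathbb{C}$ be a holomorphic function satisfying, for all $i,j,k$, $$\frac{\partial}{\partial\theta_k}\bigg(\frac{\partial^2W}{\partial\theta_i\partial z_j}-\frac{\partial^2W}{\partial\theta_j\partial z_i}-\sum_{p,q}\eta^{pq}\,\frac{\partial^2W}{\partial\theta_i\partial\theta_p}\,\frac{\partial^2W}{\partial\theta_j\partial\theta_q}\bigg)=0.$$ Define holomorphic vector fields on $X^0$ by $$v_i=\frac{\partial}{\partial\theta_i},\qquad h_i=\frac{\partial}{\partial z_i}+\sum_{p,q}\eta^{pq}\,\frac{\partial^2W}{\partial\theta_i\partial\theta_p}\,\frac{\partial}{\partial\theta_q},$$ which together form a frame of $\mathcal{T}_{X^0}$, define endomorphisms $I,J,K$ of $\mathcal{T}_{X^0}$ by $$I(v_i)=i\cdot v_i,\quad J(v_i)=h_i,\quad K(v_i)=-i\,h_i,\qquad I(h_i)=-i\cdot h_i,\quad J(h_i)=-v_i,\quad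 K(h_i)=-i\,v_i$$ (where a scalar factor $i$ denotes $\sqrt{-1}$), and define a symmetric bilinear form $g$ on $\mathcal{T}_{X^0}$ by $$g(v_i,v_j)=0,\qquad g(v_i,h_j)=\omega_{ij},\qquad g(h_i,h_j)=0.$$ Then $(g,I,J,K)$ is a complex hyperkähler structure on $X^0$, and the associated $2$-form $\Omega_-$ satisfies $\Omega_-=\pi^*(\omega)$; that is, $\pi|_{X^0}\colon X^0\to M$ is an affine symplectic fibration with base symplectic form $\omega$.
   Context: A complex hyperkähler structure on a complex manifold $X$ consists of a non-degenerate holomorphic symmetric bilinear form $g\colon\mathcal{T}_X\otimes\mathcal{T}_X\to\mathcal{O}_X$ on the holomorphic tangent bundle $\mathcal{T}_X$, together with three holomorphic endomorphisms $I,J,K\in\operatorname{End}(\mathcal{T}_X)$ which satisfy $I^2=J^2=K^2=IJK=-1$, preserve the metric (i.e. $g(Iu,Iw)=g(Ju,Jw)=g(Ku,Kw)=g(u,w)$), and are covariantly constant for the holomorphic Levi-Civita connection of $g$. One sets $\Omega_I(u,w)=g(u,I(w))$, $\Omega_J(u,w)=g(u,J(w))$, $\Omega_K(u,w)=g(u,K(w))$ and $\Omega_\pm=\Omega_J\pm\sqrt{-1}\,\Omega_K$. A holomorphic map $\pi\colon X\to M$ from a complex hyperkähler manifold to a complex manifold is an affine symplectic fibration if there is a holomorphic symplectic form $\omega$ on $M$ with $\Omega_-=\pi^*(\omega)$; $\omega$ is then called the base symplectic form. Given coordinates $(z_1,\dots,z_n)$ on $M$, the induced coordinates $(z_i,\theta_j)$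 on the total space of $\mathcal{T}_M$ are obtained by writing a tangent vector as $\sum_i\theta_i\,\frac{\partial}{\partial z_i}$. *)

(* Defs.v *)
(* The field of complex numbers is R[i], for R : realType. *)
From HB Require Import structures.
From mathcomp Require Import all_boot all_order all_algebra.
From mathcomp Require Import all_classical all_reals all_analysis.
From mathcomp Require Import complex.

Set Implicit Arguments.
Unset Strict Implicit.
Unset Printing Implicit Defensive.

Import Order.TTheory GRing.Theory Num.Theory.
Import numFieldNormedType.Exports.

Local Open Scope classical_set_scope.
Local Open Scope ring_scope.

(* R[i] with the topology and norm of its modulus, as a normed space over
   itself; the library provides these only on the alias R[i]^o. *)
HB.instance Definition _ (R : realType) := NormedModule.copy R[i] R[i]^o.

(* [differentiable] is over the scalars R[i], hence complex
   differentiability; U is always open when this is used. *)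
Definition holomorphic_on (R : realType) (V W : normedModType R[i])
  (U : set V) (f : V -> W) : Prop := forall x, U x -> differentiable f x.

(* Complex geometry on an open subset U of C^m.  The holomorphic tangent
   bundle is trivialised by the coordinate fields, so a vector field is a map
   C^m -> C^m; all objects are total functions, whose values matter only on
   U. *)
Section Geometry.
Variables (R : realType) (m : nat).
Local Notation C := R[i].
Local Notation V := 'rV[C]_m.
Implicit Types (U : set V) (f : V -> C) (u w : V -> V).

Definition vector_field := V -> V.
Definition bilinear_field := V -> V -> V -> C.
Definition endo_field := V -> V -> V.

Definition bilinear_on U (b : bilinear_field) : Prop :=
  forall x, U x -> (forall a, scalar (b x a)) /\ (forall a, scalar (b x ^~ a)).

Definition symmetric_on U (b : bilinear_field) : Prop :=
  forall x, U x -> forall a c, b x a c = b x c a.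

Definition alternating_on U (b : bilinear_field) : Prop :=
  forall x, U x -> forall a, b x a a = 0.

Definition nondegenerate_on U (b : bilinear_field) : Prop :=
  forall x, U x -> forall a, (forall c, b x a c = 0) -> a = 0.

(* Pairing with constant vectors amounts to taking the coefficients in the
   coordinate frame. *)
Definition holomorphic_bilinear U (b : bilinear_field) : Prop :=
  bilinear_on U b /\ forall a c, holomorphic_on U (fun x => b x a c).

Definition endo_on U (E : endo_field) : Prop :=
  forall x, U x -> linear (E x).

Definition holomorphic_endo U (E : endo_field) : Prop :=
  endo_on U E /\ forall a, holomorphic_on U (fun x => E x a).

Definition lie_bracket u w : vector_field :=
  fun x => 'D_(u x) w x - 'D_(w x) u x.

(* D u w is the covariant derivative of w along u.  Since the tangent bundle
   of U is trivial, connections are determined by their action on vector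
   fields over the whole of U. *)
Record holomorphic_connection U
    (D : vector_field -> vector_field -> vector_field) : Prop := {
  connection_holomorphic : forall u w,
    holomorphic_on U u -> holomorphic_on U w -> holomorphic_on U (D u w);
  connection_addl : forall u1 u2 w,
    holomorphic_on U u1 -> holomorphic_on U u2 -> holomorphic_on U w ->
    forall x, U x -> D (fun y => u1 y + u2 y) w x = D u1 w x + D u2 w x;
  connection_scalel : forall f u w,
    holomorphic_on U f -> holomorphic_on U u -> holomorphic_on U w ->
    forall x, U x -> D (fun y => f y *: u y) w x = f x *: D u w x;
  connection_addr : forall u w1 w2,
    holomorphic_on U u -> holomorphic_on U w1 -> holomorphic_on U w2 ->
    forall x, U x -> D u (fun y => w1 y + w2 y) x = D u w1 x + D u w2 x;
  connection_leibniz : forall f u w,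
    holomorphic_on U f -> holomorphic_on U u -> holomorphic_on U w ->
    forall x, U x ->
      D u (fun y => f y *: w y) x = 'D_(u x) f x *: w x + f x *: D u w x
}.

Record levi_civita U (g : bilinear_field)
    (D : vector_field -> vector_field -> vector_field) : Prop := {
  levi_civita_connection : holomorphic_connection U D;
  levi_civita_torsion_free : forall u w,
    holomorphic_on U u -> holomorphic_on U w ->
    forall x, U x -> D u w x - D w u x = lie_bracket u w x;
  levi_civita_metric : forall u w1 w2,
    holomorphic_on U u -> holomorphic_on U w1 -> holomorphic_on U w2 ->
    forall x, U x ->
      'D_(u x) (fun y => g y (w1 y) (w2 y)) x =
      g x (D u w1 x) (w2 x) + g x (w1 x) (D u w2 x)
}.

Definition covariantly_constant U
    (D : vector_field -> vector_field -> vector_field)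
    (E : endo_field) : Prop :=
  forall u w, holomorphic_on U u -> holomorphic_on U w ->
  forall x, U x -> D u (fun y => E y (w y)) x = E x (D u w x).

Definition preserves_form U (g : bilinear_field) (E : endo_field) : Prop :=
  forall x, U x -> forall a c, g x (E x a) (E x c) = g x a c.

Record complex_hyperkahler U (g : bilinear_field) (I J K : endo_field)
    : Prop := {
  hyperkahler_form : holomorphic_bilinear U g;
  hyperkahler_symmetric : symmetric_on U g;
  hyperkahler_nondegenerate : nondegenerate_on U g;
  hyperkahler_I : holomorphic_endo U I;
  hyperkahler_J : holomorphic_endo U J;
  hyperkahler_K : holomorphic_endo U K;
  hyperkahler_II : forall x, U x -> forall a, I x (I x a) = - a;
  hyperkahler_JJ : forall x, U x -> forall a, J x (J x a) = - a;
  hyperkahler_KK : forall x, U x -> forall a, K x (K x a) = - a;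
  hyperkahler_IJK : forall x, U x -> forall a, I x (J x (K x a)) = - a;
  hyperkahler_preserves_I : preserves_form U g I;
  hyperkahler_preserves_J : preserves_form U g J;
  hyperkahler_preserves_K : preserves_form U g K;
  (* The Levi-Civita connection is unique because g is non-degenerate, so
     asserting existence here is the strong reading. *)
  hyperkahler_parallel : exists2 D, levi_civita U g D &
    [/\ covariantly_constant U D I, covariantly_constant U D J
      & covariantly_constant U D K]
}.

Definition Omega_of (g : bilinear_field) (E : endo_field) : bilinear_field :=
  fun x a c => g x a (E x c).

Definition Omega_minus (g : bilinear_field) (J K : endo_field)
    : bilinear_field :=
  fun x a c => Omega_of g J x a c - 'i%C * Omega_of g K x a c.

(* (d b)(a, c, e) evaluated on constant vector fields, whose brackets
   vanish. *)
Definition closed_form_on U (b : bilinear_field) : Prop :=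
  forall x, U x -> forall a c e,
    'D_a (fun y => b y c e) x + 'D_c (fun y => b y e a) x
      + 'D_e (fun y => b y a c) x = 0.

Record holomorphic_symplectic U (b : bilinear_field) : Prop := {
  symplectic_holomorphic : holomorphic_bilinear U b;
  symplectic_alternating : alternating_on U b;
  symplectic_nondegenerate : nondegenerate_on U b;
  symplectic_closed : closed_form_on U b
}.

End Geometry.

Definition pullback_form (R : realType) (m k : nat)
    (p : 'rV[R[i]]_m -> 'rV[R[i]]_k) (b : bilinear_field R k)
    : bilinear_field R m :=
  fun x a c => b (p x) ('d p x a) ('d p x c).

(* p : U -> M, for U in C^m and M in C^k open, is an affine symplectic
   fibration with base symplectic form b. *)
Record affine_symplectic_fibration (R : realType) (m k : nat)
    (U : set 'rV[R[i]]_m) (g : bilinear_field R m) (I J K : endo_field R m)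
    (M : set 'rV[R[i]]_k) (p : 'rV[R[i]]_m -> 'rV[R[i]]_k)
    (b : bilinear_field R k) : Prop := {
  fibration_hyperkahler : complex_hyperkahler U g I J K;
  fibration_holomorphic : holomorphic_on U p;
  fibration_maps : forall x, U x -> M (p x);
  fibration_symplectic : holomorphic_symplectic M b;
  fibration_pullback : forall x, U x -> forall a c,
    Omega_minus g J K x a c = pullback_form p b x a c
}.

(* The total space X of the tangent bundle of M = C^n is C^(n + n), a point
   being row_mx z theta. *)
Section TangentBundle.
Variables (R : realType) (n : nat).
Local Notation C := R[i].
Local Notation X := 'rV[C]_(n + n).

Definition tangent_proj : X -> 'rV[C]_n := lsubmx.

Definition d_z (j : 'I_n) : X := delta_mx 0 (lshift n j).
Definition d_theta (j : 'I_n) : X := delta_mx 0 (rshift n j).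

(* dz^p /\ dz^q, normalised by
   (dz^p /\ dz^q)(a, c) = dz^p(a) dz^q(c) - dz^p(c) dz^q(a). *)
Definition wedge_dz (p q : 'I_n) (a c : 'rV[C]_n) : C :=
  a 0 p * c 0 q - c 0 p * a 0 q.

Definition base_form (om : 'M[C]_n) : bilinear_field R n :=
  fun _ a c => \sum_p \sum_q om p q * wedge_dz p q a c.

Definition v_field (j : 'I_n) : vector_field R (n + n) := fun _ => d_theta j.

Definition h_field (eta : 'M[C]_n) (W : X -> C) (j : 'I_n)
    : vector_field R (n + n) :=
  fun x => d_z j + \sum_p \sum_q
    (eta p q * 'D_(d_theta j) ('D_(d_theta p) W) x) *: d_theta q.

(* The defining values of g, I, J, K on a frame (v_j), (h_j). *)
Record metric_table (U : set X) (om : 'M[C]_n)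
    (v h : 'I_n -> vector_field R (n + n))
    (g : bilinear_field R (n + n)) : Prop := {
  metric_bilinear : bilinear_on U g;
  metric_symmetric : symmetric_on U g;
  metric_vv : forall x, U x -> forall j k, g x (v j x) (v k x) = 0;
  metric_vh : forall x, U x -> forall j k, g x (v j x) (h k x) = om j k;
  metric_hh : forall x, U x -> forall j k, g x (h j x) (h k x) = 0
}.

Record quaternion_table (U : set X)
    (v h : 'I_n -> vector_field R (n + n))
    (I J K : endo_field R (n + n)) : Prop := {
  endo_I : endo_on U I;
  endo_J : endo_on U J;
  endo_K : endo_on U K;
  I_v : forall x, U x -> forall j, I x (v j x) = 'i%C *: v j x;
  J_v : forall x, U x -> forall j, J x (v j x) = h j x;
  K_v : forall x, U x -> forall j, K x (v j x) = - 'i%C *: h j x;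
  I_h : forall x, U x -> forall j, I x (h j x) = - 'i%C *: h j x;
  J_h : forall x, U x -> forall j, J x (h j x) = - v j x;
  K_h : forall x, U x -> forall j, K x (h j x) = - 'i%C *: v j x
}.

End TangentBundle.

(* Main.v *)
(**
The statement rests on the fact that partial derivatives of a holomorphic
function of several variables are again holomorphic and commute.  Goursat's
theorem, by bisection of rectangles, applied to
[s + i t |-> (f (x + e^(s + i t) v) - f x) / e^(s + i t)] shows that the mean
of this function over a period in [t] does not depend on [s]; letting [s] tend
to [-oo] gives Cauchy's formula for [D_v f x] as a mean over a circle.  Cauchy
estimates then make [D f] locally Lipschitz, and the resulting second order
Taylor bound allows differentiating the circle mean.

For the geometry, let [N] be the matrix of vertical components of the [h_j].
The Plebanski equation says that the [h_j] commute.  The connection whose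
matrix along [u], in both the frame [v] and the frame [h], is minus the
derivative of [N] along the vertical lift of the projection of [u] is then
torsion-free; it is metric because the Hessian of [W] is symmetric, and [I],
[J], [K] are parallel because they have constant coefficients in the frame and
mix [v] and [h] only through the identification [v_j <-> h_j].
*)

From HB Require Import structures.
Require Import Defs.
From mathcomp Require Import all_boot all_order all_algebra.
From mathcomp Require Import all_classical all_reals all_analysis.
From mathcomp Require Import complex ring lra.
Import Order.TTheory GRing.Theory Num.Theory.
Import numFieldNormedType.Exports.
Local Open Scope classical_set_scope.
Local Open Scope ring_scope.

Set Implicit Arguments.
Unset Strict Implicit.
Unset Printing Implicit Defensive.
Local Open Scope complex_scope.

(** * The real-valued norm of a complex normed module *)

(** The exponential turns circles into vertical segments, so that rectangles are the only contours
    ever needed, and periodicity cancels the two horizontal sides. Cauchy's formula then becomes an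
    operator [circle_mean], linear in the function and bounded by its supremum over the radius.
    Applying it to a Taylor remainder, rather than to [f], is what gives the second differentiation;
    reading it once more as Cauchy's formula for ['D_w f] gives the symmetry of second derivatives.
    Numerical constants are generous throughout, as only finiteness and orders of magnitude matter.
    On the geometric side [W] enters only through [N] and three identities on its derivatives, and
    tensors given by tables on a frame are replaced by explicit ones in frame coordinates. *)

Section RealNorm.
Context (R : realType).
Local Notation C := R[i].

(** The norm takes values in [R[i]], whose order is only partial; its real part lets all estimates
    run in the totally ordered field [R]. *)
Definition rnorm (V : normedModType C) (v : V) : R := complex.Re `|v|.

Section Module.
Context (V : normedModType C).
Implicit Types (u v : V) (c : C).

Lemma normrE v : `|v| = (rnorm v)%:C.
Proof. by rewrite /rnorm RRe_real ?normr_real. Qed.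

Lemma rnorm_ge0 v : 0 <= rnorm v.
Proof. by rewrite -ler0c -normrE. Qed.

Lemma rnorm0 : rnorm (0 : V) = 0.
Proof. by rewrite /rnorm normr0. Qed.

Lemma rnorm_eq0 v : (rnorm v == 0) = (v == 0).
Proof.
rewrite -(normr_eq0 v) normrE; apply/eqP/eqP => [->//|].
by move=> /complexI.
Qed.

Lemma rnormN v : rnorm (- v) = rnorm v.
Proof. by rewrite /rnorm normrN. Qed.

Lemma rnormD u v : rnorm (u + v) <= rnorm u + rnorm v.
Proof. by rewrite -lecR raddfD/= -!normrE ler_normD. Qed.

Lemma rnormZ c v : rnorm (c *: v) = rnorm (c : C) * rnorm v.
Proof. by apply: complexI; rewrite rmorphM/= -!normrE normrZ. Qed.

End Module.

Lemma rnormM (a b : C) : rnorm (a * b) = rnorm a * rnorm b.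
Proof. exact: (rnormZ a b). Qed.

Lemma rnormV (a : C) : rnorm a^-1 = (rnorm a)^-1.
Proof.
apply: complexI; rewrite -normrE normfV normrE.
by rewrite fmorphV.
Qed.

Lemma rnormR (a : R) : rnorm (a%:C : C) = `|a|.
Proof. by rewrite /rnorm normc_def /= expr0n addr0 sqrtr_sqr. Qed.

Lemma rnorm_i : rnorm ('i%C : C) = 1.
Proof. by rewrite /rnorm normc_def /= expr0n/= add0r expr1n sqrtr1. Qed.

Lemma Re_le_rnorm (z : C) : `|complex.Re z| <= rnorm z.
Proof. by rewrite -lecR -normrE normc_ge_Re. Qed.

Lemma Im_le_rnorm (z : C) : `|complex.Im z| <= rnorm z.
Proof.
have := Re_le_rnorm (z * 'i%C); rewrite rnormM rnorm_i mulr1.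
by rewrite ReiNIm normrN.
Qed.

Lemma rnorm_le_ReIm (z : C) : rnorm z <= `|complex.Re z| + `|complex.Im z|.
Proof.
rewrite [in leLHS](complexE z) (le_trans (rnormD _ _))// rnormM rnorm_i mul1r.
by rewrite !rnormR.
Qed.

Section Topology.
Context (V W : normedModType C).

Lemma near_rnormP (x : V) (P : set V) :
  (\forall y \near x, P y) <->
  exists2 d : R, 0 < d & forall h, rnorm h < d -> P (x + h).
Proof.
split=> [/nbhs_ballP[e /= e0 eP]|[d d0 dP]].
  have eR : e = (complex.Re e)%:C by rewrite RRe_real// gtr0_real.
  exists (complex.Re e); first by rewrite -ltcR -eR.
  move=> h hd; apply: eP; rewrite -ball_normE/= opprD addrA subrr add0r normrN.
  by rewrite normrE eR ltcR.
apply/nbhs_ballP; exists d%:C; first by rewrite /= ltcR.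
move=> y; rewrite -ball_normE/= distrC normrE ltcR => /dP.
by rewrite addrC subrK.
Qed.

Lemma continuous_rnormP (f : V -> W) (x : V) :
  {for x, continuous f} <->
  forall e : R, 0 < e -> exists2 d : R, 0 < d & forall h, rnorm h < d ->
    rnorm (f (x + h) - f x) < e.
Proof.
split=> [/cvgrPdist_lt cf e e0|cf].
  have /near_rnormP[d d0 dP] := cf e%:C ltac:(by rewrite ltcR).
  by exists d => // h /dP; rewrite distrC normrE ltcR.
apply/cvgrPdist_lt => e e0.
have eR : e = (complex.Re e)%:C by rewrite RRe_real// gtr0_real.
have [d d0 dP] := cf (complex.Re e) ltac:(by rewrite -ltcR -eR).
by apply/near_rnormP; exists d => // h /dP; rewrite distrC normrE eR ltcR.
Qed.

Lemma linear_continuous_bounded (A : {linear V -> W}) :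
  continuous A -> exists2 K : R, 0 < K & forall h, rnorm (A h) <= K * rnorm h.
Proof.
move=> cA.
have /continuous_rnormP/(_ _ ltr01)[d d0 dP] := cA 0.
exists (2 / d); first by rewrite divr_gt0.
move=> h; have [->|h0] := eqVneq h 0; first by rewrite linear0 !rnorm0 mulr0.
have nh : 0 < rnorm h by rewrite lt_neqAle rnorm_ge0 eq_sym rnorm_eq0 h0.
(* [t *: h] has norm [d / 2], inside the ball on which [A] stays below 1; homogeneity does the
   rest. *)
pose t := d / 2 / rnorm h.
have t0 : 0 < t by rewrite !divr_gt0.
have := dP (t%:C *: h); rewrite rnormZ rnormR gtr0_norm//.
rewrite /t mulfVK ?gt_eqF// ltr_pdivrMr// => /(_ ltac:(lra)).
rewrite add0r linear0 subr0 linearZ rnormZ rnormR gtr0_norm// => /ltW.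
by rewrite -ler_pdivlMl// invf_div mulr1 => /le_trans; apply; rewrite invf_div mulrC.
Qed.

Lemma linear_bounded_continuous_rnorm (A : {linear V -> W}) (K : R) :
  (forall h, rnorm (A h) <= K * rnorm h) -> continuous A.
Proof.
move=> AK x; apply/continuous_rnormP => e e0.
have K1 : 0 < `|K| + 1 by rewrite ltr_wpDl.
exists (e / (`|K| + 1)) => [|h]; first by rewrite divr_gt0.
rewrite ltr_pdivlMr// => he; rewrite raddfD/= addrC addKr.
apply: le_lt_trans (AK h) _; apply: le_lt_trans he.
rewrite mulrC ler_wpM2l ?rnorm_ge0//.
by have := ler_norm K; lra.
Qed.

Lemma differentiable_rnorm (f : V -> W) (x : V) : differentiable f x ->
  forall e : R, 0 < e -> exists2 d : R, 0 < d & forall h, rnorm h < d ->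
    rnorm (f (x + h) - f x - 'd f x h) <= e * rnorm h.
Proof.
move=> df e e0; have /eqaddoP := diff_locally df.
move=> /(_ e%:C ltac:(by rewrite ltcR))/near_rnormP[d d0 dP].
exists d => // h /dP; rewrite add0r /= -lecR rmorphM -!normrE /=.
by rewrite /shift/= ?fctE -normrE opprD addrA [h + x]addrC.
Qed.

(** The bound [K] makes [A] continuous, and a continuous linear first-order approximation is unique,
    so the differential is identified along the way. *)
Lemma rnorm_differentiable (f : V -> W) (x : V) (A : {linear V -> W}) (K : R) :
  (forall h, rnorm (A h) <= K * rnorm h) ->
  (forall e : R, 0 < e -> exists2 d : R, 0 < d & forall h, rnorm h < d ->
    rnorm (f (x + h) - f x - A h) <= e * rnorm h) ->
  differentiable f x /\ 'd f x = A :> (V -> W).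
Proof.
move=> AK fA; have cA := linear_bounded_continuous_rnorm AK.
have E : f \o shift x = cst (f x) + A +o_ 0 id.
  apply/eqaddoP => e e0.
  have eR : e = (complex.Re e)%:C by rewrite RRe_real// gtr0_real.
  have [d d0 dP] := fA (complex.Re e) ltac:(by rewrite -ltcR -eR).
  apply/near_rnormP; exists d => // h /dP.
  rewrite add0r -lecR rmorphM/= -eR -!normrE.
  rewrite ?fctE /=. by rewrite ?fctE opprD addrA [h + x]addrC.
have dA := diff_unique cA E; split => //.
by apply/diff_locallyP; rewrite dA.
Qed.

End Topology.
End RealNorm.

(** * Integrals of complex-valued functions of a real variable *)

Section ComplexIntegral.
Context (R : realType).
Local Notation C := R[i].
Local Notation mu := (@lebesgue_measure R).
Implicit Types (a b c t : R) (g : R -> C).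

Lemma continuous_real_complexP g (x : R) :
  {for x, continuous g} <->
  forall e : R, 0 < e -> exists2 d : R, 0 < d & forall h : R, `|h| < d ->
    rnorm (g (x + h) - g x) < e.
Proof.
split=> [/cvgrPdist_lt cg e e0|cg].
  have /nbhs_ballP[d /= d0 dP] := cg e%:C ltac:(by rewrite ltcR).
  exists d => // h hd; rewrite -ltcR -normrE distrC; apply: dP.
  by rewrite /ball/= opprD addrA subrr add0r normrN.
apply/cvgrPdist_lt => e e0.
have eR : e = (complex.Re e)%:C by rewrite RRe_real// gtr0_real.
have [d d0 dP] := cg (complex.Re e) ltac:(by rewrite -ltcR -eR).
apply/nbhs_ballP; exists d => // y; rewrite /ball/= distrC => /dP.
by rewrite [x + _]addrC subrK -ltcR -normrE -eR distrC.
Qed.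

Lemma continuous_Re g : continuous g -> continuous (fun t => complex.Re (g t)).
Proof.
move=> cg x; apply/cvgrPdist_lt => e e0.
have [d d0 dP] := (continuous_real_complexP g x).1 (cg x) _ e0.
apply/nbhs_ballP; exists d => // y; rewrite /ball/= distrC => /dP.
rewrite [x + _]addrC subrK distrC; apply: le_lt_trans.
by rewrite -raddfB; exact: Re_le_rnorm.
Qed.

Lemma continuous_Im g : continuous g -> continuous (fun t => complex.Im (g t)).
Proof.
move=> cg x; apply/cvgrPdist_lt => e e0.
have [d d0 dP] := (continuous_real_complexP g x).1 (cg x) _ e0.
apply/nbhs_ballP; exists d => // y; rewrite /ball/= distrC => /dP.
rewrite [x + _]addrC subrK distrC; apply: le_lt_trans.
by rewrite -raddfB; exact: Im_le_rnorm.
Qed.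

Lemma continuous_integrable (u : R -> R) a b :
  continuous u -> mu.-integrable `[a, b] (EFin \o u).
Proof.
move=> cu; apply: continuous_compact_integrable; first exact: segment_compact.
exact: continuous_subspaceT.
Qed.

Definition cint a b g : C :=
  (\int[mu]_(t in `[a, b]) complex.Re (g t))
  +i* (\int[mu]_(t in `[a, b]) complex.Im (g t)).

Lemma eq_cint a b g1 g2 : g1 =1 g2 -> cint a b g1 = cint a b g2.
Proof. by move=> /funext ->. Qed.

Lemma cintD a b g1 g2 : continuous g1 -> continuous g2 ->
  cint a b (fun t => g1 t + g2 t) = cint a b g1 + cint a b g2.
Proof.
move=> c1 c2; rewrite /cint.
under eq_Rintegral do rewrite raddfD/=.
under [X in _ +i* X]eq_Rintegral do rewrite raddfD/=.
rewrite !RintegralD//; apply: continuous_integrable;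
  by [exact: continuous_Re|exact: continuous_Im].
Qed.

(** Prepares [cintZ]: the real and imaginary parts of [k * g] are real combinations of those of
    [g]. *)
Lemma RintegralZD (r s : R) a b (u v : R -> R) : continuous u -> continuous v ->
  \int[mu]_(t in `[a, b]) (r * u t + s * v t) =
  r * \int[mu]_(t in `[a, b]) u t + s * \int[mu]_(t in `[a, b]) v t.
Proof.
move=> cu cv; rewrite RintegralD//; last 2 first.
- by apply: continuous_integrable => t; apply: cvgMr; apply: cu.
- by apply: continuous_integrable => t; apply: cvgMr; apply: cv.
by rewrite !RintegralZl//; exact: continuous_integrable.
Qed.

Lemma cintZ a b (k : C) g : continuous g ->
  cint a b (fun t => k * g t) = k * cint a b g.
Proof.
move=> cg; rewrite /cint.
have := RintegralZD (complex.Re k) (- complex.Im k) a b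
  (continuous_Re cg) (continuous_Im cg).
have := RintegralZD (complex.Re k) (complex.Im k) a b
  (continuous_Im cg) (continuous_Re cg).
case: k => p q /= E1 E2; apply/eqP; rewrite eq_complex /= -mulNr -E1 -E2.
by apply/andP; split; apply/eqP; apply: eq_Rintegral => t _; case: (g t) => x y;
  rewrite //= mulNr.
Qed.

Lemma cint_itvD a b c g : a <= b -> b <= c -> continuous g ->
  cint a c g = cint a b g + cint b c g.
Proof.
move=> ab bc cg.
suff H (u : R -> R) : continuous u ->
    \int[mu]_(t in `[a, c]) u t =
    \int[mu]_(t in `[a, b]) u t + \int[mu]_(t in `[b, c]) u t.
  by rewrite /cint (H _ (continuous_Re cg)) (H _ (continuous_Im cg)).
move=> cu.
have := @Rintegral_itvB R u (BLeft a) (BRight c) b (continuous_integrable a c cu).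
rewrite !bnd_simp => /(_ ab bc).
(* The second piece comes out open at [b]; adding that point does not change the integral. *)
rewrite Rintegral_itv_obnd_cbnd; first by move=> <-; rewrite addrC subrK.
apply: integrableS (continuous_integrable b c cu) => //.
by apply: subset_itv; rewrite bnd_simp.
Qed.

Lemma fine_lebesgue_measure_itv a b : a <= b -> fine (mu `[a, b]) = b - a.
Proof.
move=> ab; have -> := @lebesgue_measure_itv R `[a, b].
by rewrite /= lte_fin; case: ltgtP ab => //= -> _; rewrite subrr.
Qed.

Lemma le_normr_Rintegral_itv a b (M : R) (u : R -> R) : a <= b -> continuous u ->
  (forall t, a <= t <= b -> `|u t| <= M) ->
  `|\int[mu]_(t in `[a, b]) u t| <= M * (b - a).
Proof.
move=> ab cu uM; apply: le_trans (le_normr_Rintegral _ _) _ => //.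
  exact: continuous_integrable.
have -> : M * (b - a) = \int[mu]_(_ in `[a, b]) M.
  by rewrite Rintegral_cst// fine_lebesgue_measure_itv.
apply: le_Rintegral => //.
- by apply: continuous_integrable => t; apply: cvg_norm; apply: cu.
- by apply: continuous_integrable => t; exact: cvg_cst.
Qed.

(** The factor 2 is the price of bounding real and imaginary parts separately; it propagates into
    all later constants. *)
Lemma rnorm_cint a b (M : R) g : a <= b -> continuous g ->
  (forall t, a <= t <= b -> rnorm (g t) <= M) ->
  rnorm (cint a b g) <= 2 * M * (b - a).
Proof.
move=> ab cg gM; apply: le_trans (rnorm_le_ReIm _) _ => /=.
have H1 := le_normr_Rintegral_itv ab (continuous_Re cg)
  (fun t tab => le_trans (Re_le_rnorm _) (gM t tab)).
have H2 := le_normr_Rintegral_itv ab (continuous_Im cg)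
  (fun t tab => le_trans (Im_le_rnorm _) (gM t tab)).
by rewrite -mulrA mulr2n mulrDl mul1r lerD.
Qed.

Lemma cint_cst a b (k : C) : a <= b -> cint a b (fun=> k) = k * (b - a)%:C.
Proof.
move=> ab; rewrite /cint !Rintegral_cst// fine_lebesgue_measure_itv//.
by case: k => p q; simpc.
Qed.

Lemma Rintegral_id a b : a <= b ->
  \int[mu]_(t in `[a, b]) t = (b ^+ 2 - a ^+ 2) / 2.
Proof.
rewrite le_eqVlt => /predU1P[->|ab].
  by rewrite set_itv1 Rintegral_set1 subrr mul0r.
pose F := fun t : R => t ^+ 2 / 2.
have dF (x : R) : is_derive x 1 F x.
  by rewrite /F; apply: is_derive_eq; rewrite /GRing.scale/=; field.
have cF : continuous F.
  move=> x; apply: differentiable_continuous; apply/derivable1_diffP.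
  exact: ex_derive.
rewrite /Rintegral (@continuous_FTC2 R id F a b)//=.
- by rewrite /F mulrBl.
- by apply: continuous_subspaceT => x; exact: cvg_id.
- split => [x _| |]; first exact: ex_derive.
    by apply: cvg_at_right_filter; exact: cF.
  by apply: cvg_at_left_filter; exact: cF.
- by move=> x _; rewrite derive1E; exact: derive_val.
Qed.

Lemma cint_affine a b (k l : C) : a <= b ->
  cint a b (fun t => k + l * t%:C) =
  k * (b - a)%:C + l * ((b ^+ 2 - a ^+ 2) / 2)%:C.
Proof.
move=> ab.
have cC : continuous (fun t : R => t%:C).
  move=> x; apply/continuous_real_complexP => e e0; exists e => // h he.
  by rewrite -raddfB/= rnormR addrAC subrr add0r.
rewrite cintD; last 2 first.
- by move=> t; exact: cvg_cst.
- by move=> t; apply: cvgMr; exact: cC.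
rewrite cint_cst// cintZ//; congr (_ + _ * _).
rewrite /cint/= Rintegral_id// Rintegral_cst// mul0r.
by [].
Qed.

End ComplexIntegral.

(** * Goursat's theorem *)

Section Goursat.
Context (R : realType).
Local Notation C := R[i].
Implicit Types (a b c d x y : R) (h g : C -> C) (z w : C).

Definition cdiff h z := exists l : C, forall e : R, 0 < e ->
  exists2 d : R, 0 < d & forall w, rnorm w < d ->
    rnorm (h (z + w) - h z - l * w) <= e * rnorm w.

Lemma continuous_horizontal h y : continuous h -> continuous (fun x => h (x +i* y)).
Proof.
move=> ch x; apply/continuous_real_complexP => e e0.
have [d d0 dP] := (continuous_rnormP h (x +i* y)).1 (ch _) _ e0.
exists d => // t td; have := dP t%:C; rewrite rnormR => /(_ td).
by simpc.
Qed.

Lemma continuous_vertical h x : continuous h -> continuous (fun y => h (x +i* y)).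
Proof.
move=> ch y; apply/continuous_real_complexP => e e0.
have [d d0 dP] := (continuous_rnormP h (x +i* y)).1 (ch _) _ e0.
exists d => // t td; have := dP ('i%C * t%:C); rewrite rnormM rnorm_i rnormR mul1r.
by move=> /(_ td); simpc.
Qed.

(** The integral of [h dz] counterclockwise round the rectangle: bottom minus top, plus [i] times
    right minus left since [dz = i dy] on vertical sides. *)
Definition rectint h a b c d : C :=
  cint a b (fun x => h (x +i* c)) - cint a b (fun x => h (x +i* d))
  + 'i%C * (cint c d (fun y => h (b +i* y)) - cint c d (fun y => h (a +i* y))).

Lemma rectint_splith h a m b c d : a <= m -> m <= b -> continuous h ->
  rectint h a b c d = rectint h a m c d + rectint h m b c d.
Proof.
move=> am mb ch; rewrite /rectint.
rewrite !(cint_itvD am mb (continuous_horizontal ch)).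
by ring.
Qed.

Lemma rectint_splitv h a b c m d : c <= m -> m <= d -> continuous h ->
  rectint h a b c d = rectint h a b c m + rectint h a b m d.
Proof.
move=> am mb ch; rewrite /rectint.
rewrite !(cint_itvD am mb (continuous_vertical ch)).
by ring.
Qed.

Lemma rectintD h g a b c d : continuous h -> continuous g ->
  rectint (fun z => h z + g z) a b c d = rectint h a b c d + rectint g a b c d.
Proof.
move=> ch cg; rewrite /rectint.
rewrite !cintD; try by [exact: continuous_horizontal|exact: continuous_vertical].
by ring.
Qed.

(** The 4 is two parallel sides times the factor 2 of [rnorm_cint]. *)
Lemma rectint_bound h a b c d (M : R) : a <= b -> c <= d -> continuous h ->
  (forall x y, a <= x <= b -> c <= y <= d -> rnorm (h (x +i* y)) <= M) ->
  rnorm (rectint h a b c d) <= 4 * M * (b - a + (d - c)).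
Proof.
move=> ab cd ch hM; rewrite /rectint.
apply: le_trans (rnormD _ _) _; rewrite rnormM rnorm_i mul1r.
have B := rnormD (cint a b (fun x => h (x +i* c))) (- cint a b (fun x => h (x +i* d))).
have B' := rnormD (cint c d (fun y => h (b +i* y))) (- cint c d (fun y => h (a +i* y))).
rewrite !rnormN in B B'.
have H y : c <= y <= d -> rnorm (cint a b (fun x => h (x +i* y))) <= 2 * M * (b - a).
  by move=> yd; apply: rnorm_cint => // [|t tab]; [exact: continuous_horizontal|exact: hM].
have V x : a <= x <= b -> rnorm (cint c d (fun y => h (x +i* y))) <= 2 * M * (d - c).
  by move=> xd; apply: rnorm_cint => // [|t tab]; [exact: continuous_vertical|exact: hM].
have := H c; have := H d; have := V a; have := V b.
rewrite !lexx ab cd => /(_ isT) V1 /(_ isT) V2 /(_ isT) H1 /(_ isT) H2.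
by lra.
Qed.

Lemma rectint_affine (k l : C) a b c d : a <= b -> c <= d ->
  rectint (fun z => k + l * z) a b c d = 0.
Proof.
move=> ab cd; rewrite /rectint.
have Hh (y : R) : cint a b (fun x => k + l * (x +i* y)) =
    (k + l * 'i%C * y%:C) * (b - a)%:C + l * ((b ^+ 2 - a ^+ 2) / 2)%:C.
  rewrite -cint_affine//; apply: eq_cint => t.
  rewrite {1}(complexE (t +i* y))/=. ring.
have Hv (x : R) : cint c d (fun y => k + l * (x +i* y)) =
    (k + l * x%:C) * (d - c)%:C + l * 'i%C * ((d ^+ 2 - c ^+ 2) / 2)%:C.
  rewrite -cint_affine//; apply: eq_cint => t.
  by rewrite {1}(complexE (x +i* t))/=; ring.
by rewrite !Hh !Hv !raddfB/=; ring.
Qed.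

Lemma continuous_affine (k l : C) : continuous (fun z : C => k + l * z).
Proof.
move=> z; apply/continuous_rnormP => e e0.
have l1 : 0 < rnorm l + 1 by rewrite ltr_wpDl// rnorm_ge0.
exists (e / (rnorm l + 1)) => [|w]; first by rewrite divr_gt0.
rewrite ltr_pdivlMr// => we.
rewrite (_ : _ - _ = l * w); last by ring.
by rewrite rnormM; have := rnorm_ge0 w; lra.
Qed.

(** Subtracting the affine approximation does not change the contour integral. What remains is small
    relative to the distance to the base point; that distance and the boundary length each
    contribute one factor [b - a + (d - c)]. *)
Lemma cdiff_rectint_small h x0 y0 (e : R) : continuous h -> cdiff h (x0 +i* y0) ->
  0 < e -> exists2 r : R, 0 < r & forall a b c d,
    a <= x0 <= b -> c <= y0 <= d -> b - a < r -> d - c < r ->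
    rnorm (rectint h a b c d) <= e * (b - a + (d - c)) ^+ 2.
Proof.
move=> ch [l hl] e0.
(* The 4 compensates the one in [rectint_bound]; halving [r] below keeps the displacement, at most
   the sum of the two sides, under [r]. *)
have [r r0 rP] := hl (e / 4) ltac:(by rewrite divr_gt0).
exists (r / 2); first by rewrite divr_gt0.
move=> a b c d /andP[ax xb] /andP[cy yd] ar cr.
have ab : a <= b by lra. have cd : c <= d by lra.
pose k := h (x0 +i* y0) - l * (x0 +i* y0).
pose g z := h z + (- k + - l * z).
have cg : continuous g.
  by move=> z; exact: (continuousD (ch z) (@continuous_affine (- k) (- l) z)).
have -> : rectint h a b c d = rectint g a b c d.
  have := rectintD a b c d ch (@continuous_affine (- k) (- l)).
  by rewrite rectint_affine// addr0.
apply: le_trans (@rectint_bound _ _ _ _ _ (e / 4 * (b - a + (d - c))) _ _ _ _) _ => //.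
  move=> x y /andP[ax' xb'] /andP[cy' yd'].
  have E : (x0 +i* y0) + ((x - x0) +i* (y - y0)) = x +i* y by simpc; congr (_ +i* _); lra.
  have W : rnorm ((x - x0) +i* (y - y0) : C) <= b - a + (d - c).
    apply: le_trans (rnorm_le_ReIm _) _ => /=.
    have : `|x - x0| <= b - a by rewrite ler_norml; lra.
    have : `|y - y0| <= d - c by rewrite ler_norml; lra.
    lra.
  have := rP ((x - x0) +i* (y - y0)) ltac:(lra); rewrite E.
  rewrite (_ : h _ - _ - _ = g (x +i* y)); last first.
    rewrite /g /k (_ : (x - x0) +i* (y - y0) = (x +i* y) - (x0 +i* y0)); first by ring.
    by simpc.
  move=> /le_trans; apply; rewrite ler_wpM2l// ltW// divr_gt0//.
by rewrite le_eqVlt; apply/orP; left; apply/eqP; field.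
Qed.

(** * Bisection of a rectangle with large contour integral *)

Section Bisection.
Variables (h : C -> C) (a b c d e : R).
Hypotheses (ab : a <= b) (cd : c <= d) (e0 : 0 < e) (ch : continuous h).

Let w n : R := (b - a) / 2 ^+ n.
Let v n : R := (d - c) / 2 ^+ n.

Let bad n (p : R * R) : Prop :=
  ~ rnorm (rectint h p.1 (p.1 + w n) p.2 (p.2 + v n)) <= e * (w n + v n) ^+ 2.

Let w_ge0 n : 0 <= w n.
Proof. by rewrite divr_ge0// ?subr_ge0// exprn_ge0. Qed.

Let v_ge0 n : 0 <= v n.
Proof. by rewrite divr_ge0// ?subr_ge0// exprn_ge0. Qed.

Let wS n : w n = w n.+1 + w n.+1.
Proof. by rewrite /w exprS; field; rewrite expf_eq0 pnatr_eq0 andbF. Qed.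

Let vS n : v n = v n.+1 + v n.+1.
Proof. by rewrite /v exprS; field; rewrite expf_eq0 pnatr_eq0 andbF. Qed.

(** The threshold is quadratic in the size, so halving divides it by 4, which is the number of
    quarters: if all four were good, their sum would be too. *)
Let bad_quarter n p : bad n p -> exists q, [/\ bad n.+1 q,
  p.1 <= q.1, q.1 + w n.+1 <= p.1 + w n, p.2 <= q.2 & q.2 + v n.+1 <= p.2 + v n].
Proof.
case: p => x y; rewrite /bad/= => B.
have [w0 v0] := (w_ge0 n.+1, v_ge0 n.+1).
apply: contrapT => nq; apply: B.
have good q : x <= q.1 -> q.1 <= x + w n.+1 -> y <= q.2 -> q.2 <= y + v n.+1 ->
    rnorm (rectint h q.1 (q.1 + w n.+1) q.2 (q.2 + v n.+1))
      <= e * (w n.+1 + v n.+1) ^+ 2.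
  move=> q1 q2 q3 q4; apply: contrapT => qB; apply: nq; exists q; split=> //=.
    by rewrite (wS n) addrA lerD2r.
  by rewrite (vS n) addrA lerD2r.
rewrite (wS n) (vS n) !addrA.
have xw : x <= x + w n.+1 by rewrite lerDl.
have xww : x + w n.+1 <= x + w n.+1 + w n.+1 by rewrite lerDl.
have yv : y <= y + v n.+1 by rewrite lerDl.
have yvv : y + v n.+1 <= y + v n.+1 + v n.+1 by rewrite lerDl.
have -> := rectint_splith y (y + v n.+1 + v n.+1) xw xww ch.
have -> := rectint_splitv x (x + w n.+1) yv yvv ch.
have -> := rectint_splitv (x + w n.+1) (x + w n.+1 + w n.+1) yv yvv ch.
have := good (x, y); rewrite !lexx !lerDl /= => /(_ isT w0 isT v0) G1.
have := good (x + w n.+1, y); rewrite !lexx !lerDl /= => /(_ w0 isT isT v0) G2.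
have := good (x, y + v n.+1); rewrite !lexx !lerDl /= => /(_ isT w0 v0 isT) G3.
have := good (x + w n.+1, y + v n.+1); rewrite !lexx !lerDl /= => /(_ w0 isT v0 isT) G4.
move: G1 G2 G3 G4.
set A1 := rectint _ _ _ _ _; set A2 := rectint _ _ _ _ _.
set A3 := rectint _ _ _ _ _; set A4 := rectint _ _ _ _ _ => G1 G2 G3 G4.
have := rnormD (A1 + A3) (A2 + A4); have := rnormD A1 A3; have := rnormD A2 A4.
have -> : e * (w n.+1 + w n.+1 + v n.+1 + v n.+1) ^+ 2 =
   4 * (e * (w n.+1 + v n.+1) ^+ 2) by ring.
by lra.
Qed.

Let w_small r : 0 < r -> exists n, w n < r /\ v n < r.
Proof.
move=> r0.
pose s := (b - a + (d - c)) / r.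
have s0 : 0 <= s by apply: divr_ge0; [rewrite addr_ge0 ?subr_ge0|exact: ltW].
pose n := Num.bound s; exists n.
have sn : s < 2 ^+ n.
  by rewrite (lt_trans (archi_boundP s0))// -natrX ltr_nat ltn_expl.
have p0 : 0 < 2 ^+ n :> R by rewrite exprn_gt0.
move: sn; rewrite /s ltr_pdivrMr// => sn.
split; rewrite /w /v ltr_pdivrMr// [r * _]mulrC; move: ab cd sn; set q := _ * r; lra.
Qed.

Let nested (x : nat -> R) (l : nat -> R) : (forall n, 0 <= l n) ->
  (forall n, x n <= x n.+1) -> (forall n, x n.+1 + l n.+1 <= x n + l n) ->
  exists u, forall n, x n <= u <= x n + l n.
Proof.
move=> l0 xS lS.
have xD n k : x n <= x (n + k)%N.
  by elim: k => [|k IH]; rewrite ?addn0// addnS (le_trans IH).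
have lD n k : x (n + k)%N + l (n + k)%N <= x n + l n.
  by elim: k => [|k IH]; rewrite ?addn0// addnS (le_trans _ IH).
have xl m n : x m <= x n + l n.
  have [mn|/ltnW nm] := leqP m n.
    by rewrite -(subnKC mn) (le_trans (xD m (n - m)%N))// lerDl.
  by rewrite (le_trans _ (lD n (m - n)%N))// subnKC// lerDl.
exists (sup (range x)) => n; apply/andP; split.
  apply: ub_le_sup; last by exists n.
  by exists (x 0%N + l 0%N) => _ [m _ <-].
by apply: ge_sup; [exists (x 0%N), 0%N|move=> _ [m _ <-]].
Qed.

Lemma rectint_cdiff_le :
  (forall x y, a <= x <= b -> c <= y <= d -> cdiff h (x +i* y)) ->
  rnorm (rectint h a b c d) <= e * (b - a + (d - c)) ^+ 2.
Proof.
move=> dh; apply: contrapT => B0.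
(* The choice function must be total: off the bad rectangles the successor is the dummy [(0, 0)],
   which the sequence [s] never meets. *)
have step (np : nat * (R * R)) : exists q : R * R, bad np.1 np.2 ->
  [/\ bad np.1.+1 q, np.2.1 <= q.1, q.1 + w np.1.+1 <= np.2.1 + w np.1,
      np.2.2 <= q.2 & q.2 + v np.1.+1 <= np.2.2 + v np.1].
  have [B|B] := pselect (bad np.1 np.2); last by exists (0, 0) => /B.
  by have [q qP] := bad_quarter B; exists q.
have [f fP] := choice step.
pose s := fix s n := if n is m.+1 then f (m, s m) else (a, c).
have sB n : bad n (s n).
  elim: n => [|n IH]; last by have [] := fP (n, s n) IH.
  by rewrite /bad/= /w /v expr0 !divr1 !subrKC.
have sP n : [/\ (s n).1 <= (s n.+1).1, (s n.+1).1 + w n.+1 <= (s n).1 + w n,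
    (s n).2 <= (s n.+1).2 & (s n.+1).2 + v n.+1 <= (s n).2 + v n].
  by have [] := fP (n, s n) (sB n).
have [x xP] : exists x, forall n, (s n).1 <= x <= (s n).1 + w n.
  by apply: (nested w_ge0) => n; have [] := sP n.
have [y yP] : exists y, forall n, (s n).2 <= y <= (s n).2 + v n.
  by apply: (nested v_ge0) => n; have [] := sP n.
have := dh x y; have := xP 0%N; have := yP 0%N.
rewrite /= /w /v expr0 !divr1 !subrKC => -> -> /(_ isT isT) dxy.
have [r r0 rP] := cdiff_rectint_small ch dxy e0.
have [n [wr vr]] := w_small r0.
(* Stage [n] contains the limit point and is small enough for the local estimate there, which
   contradicts its badness. *)
apply: (sB n); have := rP _ _ _ _ (xP n) (yP n).
by rewrite !(addrAC _ _ (- _)) !subrr !add0r; exact.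
Qed.

End Bisection.

Theorem goursat h a b c d : a <= b -> c <= d -> continuous h ->
  (forall x y, a <= x <= b -> c <= y <= d -> cdiff h (x +i* y)) ->
  rectint h a b c d = 0.
Proof.
move=> ab cd ch dh; apply/eqP; rewrite -rnorm_eq0; apply/eqP.
apply/le_anti; rewrite rnorm_ge0 andbT; apply/ler_addgt0Pr => e e0.
rewrite add0r.
pose p := (b - a + (d - c)) ^+ 2 + 1.
have p0 : 0 < p by rewrite ltr_wpDl// exprn_even_ge0.
apply: le_trans (rectint_cdiff_le ab cd (divr_gt0 e0 p0) ch dh) _.
by rewrite mulrAC ler_pdivrMr// ler_wpM2l ?ltW// /p; lra.
Qed.

End Goursat.

(** * Cauchy's formula for the derivative *)

Section Exponential.
Context (R : realType).
Local Notation C := R[i].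
Implicit Types (z w : C).

Definition cexp z : C :=
  (expR (complex.Re z) * cos (complex.Im z))
  +i* (expR (complex.Re z) * sin (complex.Im z)).

Lemma cexpD z w : cexp (z + w) = cexp z * cexp w.
Proof.
case: z w => a b [c d]; rewrite /cexp /= expRD cosD sinD; simpc.
by congr (_ +i* _); ring.
Qed.

Lemma cexp0 : cexp 0 = 1.
Proof. by rewrite /cexp/= expR0 cos0 sin0 mulr0 mulr1. Qed.

Lemma cexpN z : cexp (- z) = (cexp z)^-1.
Proof.
have E : cexp (- z) * cexp z = 1 by rewrite -cexpD addNr cexp0.
have z0 : cexp z != 0.
  by apply: contra_eq_neq E => ->; rewrite mulr0 eq_sym oner_neq0.
by rewrite -[LHS](mulfK z0) E mul1r.
Qed.

Lemma rnorm_cexp z : rnorm (cexp z) = expR (complex.Re z).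
Proof.
rewrite /rnorm normc_def /= !exprMn -mulrDr cos2Dsin2 mulr1 sqrtr_sqr.
by rewrite ger0_norm// expR_ge0.
Qed.

Lemma is_derive_rnorm (u : R -> R) (x l : R) : is_derive x 1 u l ->
  forall e : R, 0 < e -> exists2 d : R, 0 < d & forall h : R, `|h| < d ->
    `|u (x + h) - u x - l * h| <= e * `|h|.
Proof.
move=> [du ul] e e0.
have /derivable1_diffP/diff_locally/eqaddoP/(_ e e0)/nbhs_ballP[d /= d0 dP] := du.
exists d => // h hd; have := dP h; rewrite /ball/= sub0r normrN => /(_ hd).
rewrite ?fctE /= [h + x]addrC opprD addrA diff1E; last exact/derivable1_diffP.
by rewrite derive1E ul /GRing.scale/= [h * l]mulrC.
Qed.

(** Reduces to the real derivatives of [expR], [cos] and [sin] at 0; additivity of the exponent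
    carries the result to every point. *)
Lemma cexp_littleo (e : R) : 0 < e -> exists2 d : R, 0 < d &
  forall w, rnorm w < d -> rnorm (cexp w - 1 - w) <= e * rnorm w.
Proof.
(* [k <= 1] gives [|1 + p| <= 2] and [|sin q| <= 2 |q|]. The five error terms [T1] to [T5] add up to
   [7 * k * W], hence [e / 8]. *)
move=> e0; have [k [k0 kl ke]] : exists k, [/\ 0 < k, k <= 1 & k <= e / 8].
  exists (Num.min 1 (e / 8)).
  by rewrite lt_min ltr01 divr_gt0// !ge_min !lexx orbT.
have [d1 d10 D1] := is_derive_rnorm (is_derive_expR (0 : R)) k0.
have [d2 d20 D2] := is_derive_rnorm (is_derive_cos (0 : R)) k0.
have [d3 d30 D3] := is_derive_rnorm (is_derive_sin (0 : R)) k0.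
exists (Num.min k (Num.min d1 (Num.min d2 d3))); first by rewrite !lt_min k0 d10 d20 d30.
case=> p q; rewrite !lt_min => /and4P[wk w1 w2 w3].
have Hp := Re_le_rnorm (p +i* q); have Hq := Im_le_rnorm (p +i* q).
rewrite /= in Hp Hq; move: wk w1 w2 w3; set W := rnorm _ => wk w1 w2 w3.
have := D1 p (le_lt_trans Hp w1); have := D2 q (le_lt_trans Hq w2).
have := D3 q (le_lt_trans Hq w3).
rewrite !(add0r, expR0, sin0, cos0, mul0r, oppr0, addr0, mul1r) => S Co E.
apply: le_trans (rnorm_le_ReIm _) _.
rewrite /cexp/= !subr0.
have -> : expR p * cos q - 1 - p =
  (expR p - 1 - p) * cos q + (1 + p) * (cos q - 1) by ring.
have -> : expR p * sin q - q =
  (expR p - 1 - p) * sin q + p * sin q + (sin q - q) by ring.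
have cq : `|cos q| <= 1 by rewrite ler_norml cos_geN1 cos_le1.
have sq : `|sin q| <= 1 by rewrite ler_norml sin_geN1 sin_le1.
have sq2 : `|sin q| <= 2 * `|q|.
  have := ler_normD (sin q - q) q; rewrite subrK => /le_trans; apply.
  have := normr_ge0 q; nra.
have W0 : 0 <= W := rnorm_ge0 _.
have T1 : `|(expR p - 1 - p) * cos q| <= k * W.
  rewrite normrM; apply: le_trans (_ : k * `|p| * 1 <= _); first exact: ler_pM.
  by rewrite mulr1 ler_wpM2l// ltW.
have T2 : `|(1 + p) * (cos q - 1)| <= 2 * k * W.
  rewrite normrM -mulrA; apply: ler_pM => //.
    by apply: le_trans (ler_normD _ _) _; rewrite normr1; lra.
  by apply: le_trans Co _; rewrite ler_wpM2l// ltW.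
have T3 : `|(expR p - 1 - p) * sin q| <= k * W.
  rewrite normrM; apply: le_trans (_ : k * `|p| * 1 <= _); first exact: ler_pM.
  by rewrite mulr1 ler_wpM2l// ltW.
have T4 : `|p * sin q| <= k * (2 * W).
  rewrite normrM; apply: ler_pM => //; first by rewrite (le_trans Hp)// ltW.
  by apply: le_trans sq2 _; rewrite ler_wpM2l.
have T5 : `|sin q - q| <= k * W by apply: le_trans S _; rewrite ler_wpM2l// ltW.
have N1 := ler_normD ((expR p - 1 - p) * cos q) ((1 + p) * (cos q - 1)).
have N2 := ler_normD ((expR p - 1 - p) * sin q + p * sin q) (sin q - q).
have N3 := ler_normD ((expR p - 1 - p) * sin q) (p * sin q).
have : k * W <= e / 8 * W by rewrite ler_wpM2r.
have := mulr_ge0 (ltW e0) W0.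
lra.
Qed.

Lemma differentiable_cexp z : differentiable cexp z.
Proof.
pose A : {linear C -> C} := *:%R (cexp z).
have AK (h : C) : rnorm (A h) <= rnorm (cexp z) * rnorm h by rewrite -rnormM.
apply: (rnorm_differentiable AK _).1.
move=> e e0; have p0 : 0 < rnorm (cexp z) by rewrite rnorm_cexp expR_gt0.
have [d d0 dP] := cexp_littleo (divr_gt0 e0 p0).
exists d => // h /dP H.
rewrite cexpD (_ : _ - _ - _ = cexp z * (cexp h - 1 - h)); last by rewrite /= /GRing.scale/=; ring.
by rewrite rnormM mulrC -ler_pdivlMr// mulrAC.
Qed.

(** The point [r e^(i t)], written through [cexp] so that for [r > 0] the circle is the image of the
    vertical line over [ln r]. *)
Definition circ (r t : R) : C := cexp (ln r +i* t).

Lemma rnorm_circ r t : 0 < r -> rnorm (circ r t) = r.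
Proof. by move=> r0; rewrite rnorm_cexp/= lnK. Qed.

Lemma continuous_circ r : continuous (circ r).
Proof.
apply: (@continuous_vertical _ cexp (ln r)) => z.
exact: differentiable_continuous (differentiable_cexp z).
Qed.

End Exponential.

(** * Circle means of difference quotients *)

Section CauchyFormula.
Context (R : realType) (V : normedModType R[i]).
Local Notation C := R[i].

Lemma differentiable_cdiff (h : C -> C) (z : C) : differentiable h z -> cdiff h z.
Proof.
move=> dh; exists ('d h z 1) => e /(differentiable_rnorm dh)[d d0 dP].
exists d => // w /dP; congr (rnorm (_ - _) <= _).
by rewrite -[w in LHS]mulr1 [in LHS]linearZ /= mulrC.
Qed.

Variables (f : V -> C) (x v : V) (r1 : R).
Hypothesis (r1_gt0 : 0 < r1).
Hypothesis df : forall k : C, rnorm k <= r1 -> differentiable f (x + k *: v).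

Let H (z : C) : C := (f (x + cexp z *: v) - f x) * cexp (- z).

Let dH (z : C) : complex.Re z <= ln r1 -> differentiable H z.
Proof.
move=> zr; apply: differentiableM; last first.
  apply: (@differentiable_comp _ _ _ _ -%R (@cexp R)); last exact: differentiable_cexp.
  exact: differentiableN.
apply: differentiableB; last exact: differentiable_cst.
apply: (@differentiable_comp _ _ _ _ (fun z => x + cexp z *: v) f).
  apply: differentiableD; first exact: differentiable_cst.
  by apply: differentiableZl; exact: differentiable_cexp.
by apply: df; rewrite rnorm_cexp -ler_ln ?posrE ?expR_gt0// expRK.
Qed.

(* Clipping the real part makes H continuous on the whole plane. *)
Let clip (z : C) : C := Num.min (complex.Re z) (ln r1) +i* complex.Im z.

Let clip_id (z : C) : complex.Re z <= ln r1 -> clip z = z.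
Proof. by case: z => a b /= ab; rewrite /clip/= min_l. Qed.

Let continuous_clip : continuous clip.
Proof.
move=> z; apply/continuous_rnormP => e e0; exists (e / 2); first by rewrite divr_gt0.
case: z => a b [c d] cd; apply: le_lt_trans (rnorm_le_ReIm _) _ => /=.
have := Re_le_rnorm (c +i* d); have := Im_le_rnorm (c +i* d) => /= E1 E2.
have -> : b + d - b = d by ring.
have : `|Num.min (a + c) (ln r1) - Num.min a (ln r1)| <= `|c|.
  have c1 := ler_norm c; have := ler_norm (- c); rewrite normrN => c2.
  rewrite ler_norml !minEle; case: (leP (a + c)) => u1; case: (leP a) => u2; lra.
lra.
Qed.

Let G (z : C) : C := H (clip z).

Let continuous_G : continuous G.
Proof.
move=> z; apply: (@continuous_comp _ _ _ clip H); first exact: continuous_clip.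
by apply/differentiable_continuous/dH; rewrite /clip/= ge_min lexx orbT.
Qed.

(** Strictness matters: clipping destroys differentiability on the line [Re z = ln r1], while to its
    left [G] and [H] agree near [z]. *)
Let dG (z : C) : complex.Re z < ln r1 -> cdiff G z.
Proof.
move=> zr; have [l lP] := differentiable_cdiff (dH (ltW zr)); exists l => e /lP[d d0 dP].
exists (Num.min d (ln r1 - complex.Re z)); first by rewrite lt_min d0 subr_gt0.
move=> w; rewrite lt_min => /andP[/dP wd wr].
rewrite /G !clip_id//; first exact: ltW.
rewrite raddfD/=; have := Re_le_rnorm w; have := ler_norm (complex.Re w).
lra.
Qed.

Let GE (r t : R) : 0 < r <= r1 ->
  G (ln r +i* t) = (f (x + circ r t *: v) - f x) * (circ r t)^-1.
Proof. by move=> /andP[r0 rr]; rewrite /G clip_id ?ler_ln ?posrE//= ?(lt_le_trans r0)// /H cexpN. Qed.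

Let phi (s : R) : C := cint 0 (2 * pi) (fun t => G (s +i* t)).

(** Goursat on the rectangle over [[s, s0]] of height one period: its horizontal sides carry the
    same values, so its vertical sides have equal integrals. *)
Let phi_cst (s s0 : R) : s <= s0 -> s0 < ln r1 -> phi s = phi s0.
Proof.
move=> ss0 s0r.
have p0 : 0 <= 2 * pi :> R by rewrite mulr_ge0// pi_ge0.
have : rectint G s s0 0 (2 * pi) = 0.
  apply: (goursat ss0 p0 continuous_G) => u t /andP[_ us] _.
  exact/dG/(le_lt_trans us).
rewrite /rectint.
have -> : cint s s0 (fun u => G (u +i* (2 * pi))) = cint s s0 (fun u => G (u +i* 0)).
  apply: eq_cint => u; rewrite /G /H /clip/= !cexpN /cexp/=.
  have -> : 2 * pi = pi *+ 2 :> R by rewrite mulrC mulr_natr.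
  by rewrite cos2pi sin2pi cos0 sin0.
rewrite subrr add0r -/(phi s) -/(phi s0).
have i0 : 'i%C != 0 :> C by rewrite eq_complex /= eqxx oner_eq0.
move: (phi s) (phi s0) => p q /eqP.
by rewrite mulf_eq0 (negPf i0) subr_eq0 => /eqP.
Qed.

Theorem cauchy_derive (r : R) : 0 < r < r1 ->
  cint 0 (2 * pi) (fun t => (f (x + circ r t *: v) - f x) * (circ r t)^-1)
  = (2 * pi)%:C * 'D_v f x.
Proof.
move=> /andP[r0 rr].
have p0 : 0 < 2 * pi :> R by rewrite mulr_gt0// pi_gt0.
have dfx : differentiable f x.
  by have := df (k := 0); rewrite scale0r addr0 rnorm0; apply; rewrite ltW.
have -> : cint 0 (2 * pi) (fun t => (f (x + circ r t *: v) - f x) * (circ r t)^-1)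
    = phi (ln r).
  by apply: eq_cint => t; rewrite GE// r0 ltW.
rewrite (deriveE _ dfx); set l := 'd f x v.
apply/eqP; rewrite -subr_eq0 -rnorm_eq0; apply/eqP/le_anti.
rewrite rnorm_ge0 andbT; apply/ler_addgt0Pr => e e0; rewrite add0r.
(* [2 * (2 * pi)] is the loss in [rnorm_cint] over a period; [+ 1] covers [v = 0]. *)
pose m := 2 * (2 * pi) * (rnorm v + 1).
have m0 : 0 < m by rewrite mulr_gt0 ?mulr_gt0 ?pi_gt0// ltr_wpDl// rnorm_ge0.
have [d d0 dP] := differentiable_rnorm dfx (divr_gt0 e0 m0).
(* The mean may be computed on a smaller circle; [q] brings all its points within the distance [d]
   of [x] where the first-order estimate holds. *)
pose q := Num.min r (d / 2 / (rnorm v + 1)).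
have v1 : 0 < rnorm v + 1 by rewrite ltr_wpDl// rnorm_ge0.
have q0 : 0 < q by rewrite lt_min r0 !divr_gt0.
have qr : q <= r by rewrite ge_min lexx.
have qd : q * (rnorm v + 1) <= d / 2 by rewrite -ler_pdivlMr// ge_min lexx orbT.
rewrite -(@phi_cst (ln q) (ln r)) ?ler_ln ?ltr_ln ?posrE// ?(lt_trans r0)//.
have -> : phi (ln q) - (2 * pi)%:C * l = cint 0 (2 * pi) (fun t => G (ln q +i* t) + - l).
  have cG := continuous_vertical (x := ln q) continuous_G.
  have cl : continuous (fun _ : R => - l) by move=> t; exact: cvg_cst.
  by rewrite (cintD _ _ cG cl) cint_cst ?ltW// subr0 mulNr mulrC.
apply: le_trans (@rnorm_cint _ _ _ (e / m * rnorm v) _ _ _ _) _.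
- exact: ltW.
- have cG := continuous_vertical (x := ln q) continuous_G.
  have cl : continuous (fun _ : R => - l) by move=> t; exact: cvg_cst.
  by move=> t; exact: (continuousD (cG t) (cl t)).
- move=> t _; rewrite GE; last by rewrite q0 (le_trans qr)// ltW.
  have c0 : circ q t != 0 by rewrite -rnorm_eq0 rnorm_circ// gt_eqF.
  have := dP (circ q t *: v); rewrite rnormZ rnorm_circ// linearZ => H1.
  have H2 : q * rnorm v < d by lra.
  have -> : (f (x + circ q t *: v) - f x) * (circ q t)^-1 + - l =
     (f (x + circ q t *: v) - f x - circ q t * l) * (circ q t)^-1.
    by field.
  rewrite rnormM rnormV rnorm_circ// ler_pdivrMr// mulrAC -mulrA.
  exact: H1.
rewrite subr0 (_ : 2 * _ * _ = e * (rnorm v / (rnorm v + 1))); last first.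
  have := lt0r_neq0 (pi_gt0 R); have := lt0r_neq0 v1; rewrite /m.
  by move: (pi : R) (rnorm v) => p k k0 p0'; field; rewrite k0.
rewrite ler_piMr ?ltW// ltr_pdivrMr// mul1r ltrDl//.
Qed.

End CauchyFormula.

(** * Derivatives of holomorphic functions *)

Section HolomorphicDerivative.
Context (R : realType) (V : normedModType R[i]).
Local Notation C := R[i].
Implicit Types (f u : V -> C) (x v w h : V) (r : R).

(** Cauchy's integral for the derivative, as an operator on arbitrary [u], so that it can be applied
    to Taylor remainders and to derivatives of [f]. *)
Definition circle_mean r v u x : C :=
  ((2 * pi)^-1)%:C
  * cint 0 (2 * pi) (fun t => (u (x + circ r t *: v) - u x) * (circ r t)^-1).

Lemma pi2_gt0 : 0 < 2 * pi :> R.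
Proof. by rewrite mulr_gt0// pi_gt0. Qed.

Lemma cauchy_circle_mean f x v r r1 : 0 < r < r1 ->
  (forall k : C, rnorm k <= r1 -> differentiable f (x + k *: v)) ->
  circle_mean r v f x = 'D_v f x.
Proof.
move=> /[dup] r0 /andP[r00 r01] df; rewrite /circle_mean.
have -> := cauchy_derive (lt_trans r00 r01) df r0.
by rewrite mulrA -rmorphM/= mulVf ?gt_eqF ?pi2_gt0// mul1r.
Qed.

Lemma circ_neq0 r t : circ r t != 0 :> C.
Proof. by rewrite -rnorm_eq0 rnorm_cexp gt_eqF// expR_gt0. Qed.

Lemma circle_integrand_continuous r v u x :
  (forall t, {for x + circ r t *: v, continuous u}) ->
  continuous (fun t => (u (x + circ r t *: v) - u x) * (circ r t)^-1).
Proof.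
move=> cu t.
have c1 : {for t, continuous (fun t => x + circ r t *: v)}.
  apply: (@continuous_comp _ _ _ (circ r) (fun k : C => x + k *: v)).
    exact: continuous_circ.
  apply/continuous_rnormP => e e0; exists (e / (rnorm v + 1)).
    by rewrite divr_gt0// ltr_wpDl// rnorm_ge0.
  move=> h; rewrite ltr_pdivlMr ?ltr_wpDl ?rnorm_ge0// => he.
  rewrite opprD addrACA subrr add0r -scalerBl addrAC subrr add0r rnormZ.
  by have := rnorm_ge0 h; have := rnorm_ge0 v; lra.
apply: (@continuousM _ _ (fun t => u (x + circ r t *: v) - u x)
  (fun t => (circ r t)^-1)); last first.
  apply: (@continuousV _ _ (circ r)); first exact: circ_neq0.
  exact: continuous_circ.
apply: (@continuousB _ _ _ (fun t => u (x + circ r t *: v)) (fun=> u x)); last exact: cvg_cst.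
exact: (@continuous_comp _ _ _ (fun t => x + circ r t *: v) u).
Qed.

(** The 4 is a 2 from the difference of two values of [u] times the 2 of [rnorm_cint]. *)
Lemma circle_mean_bound r v u x (M : R) : 0 < r ->
  (forall t, {for x + circ r t *: v, continuous u}) ->
  (forall t, rnorm (u (x + circ r t *: v)) <= M) -> rnorm (u x) <= M ->
  rnorm (circle_mean r v u x) <= 4 * M / r.
Proof.
move=> r0 cu uM uxM; rewrite /circle_mean rnormM rnormR.
have ci := circle_integrand_continuous cu.
have := rnorm_cint (M := 2 * M / r) (ltW pi2_gt0) ci.
rewrite subr0 gtr0_norm ?invr_gt0 ?pi2_gt0// => H.
rewrite ler_pdivrMl ?pi2_gt0//; apply: le_trans (H _) _.
  move=> t _; rewrite rnormM rnormV rnorm_circ//; apply: ler_wpM2r; first by rewrite invr_ge0 ltW.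
  by have := rnormD (u (x + circ r t *: v)) (- u x); rewrite rnormN; have := uM t; lra.
by rewrite le_eqVlt; apply/orP; left; apply/eqP; ring.
Qed.

Lemma circle_meanD r v u1 u2 x :
  (forall t, {for x + circ r t *: v, continuous u1}) ->
  (forall t, {for x + circ r t *: v, continuous u2}) ->
  circle_mean r v (fun y => u1 y + u2 y) x =
  circle_mean r v u1 x + circle_mean r v u2 x.
Proof.
move=> /circle_integrand_continuous c1 /circle_integrand_continuous c2.
rewrite /circle_mean -mulrDr; congr (_ * _).
have <- := cintD 0 (2 * pi) c1 c2.
by apply: eq_cint => t; ring.
Qed.

Lemma circle_meanZ r v (k : C) u x :
  (forall t, {for x + circ r t *: v, continuous u}) ->
  circle_mean r v (fun y => k * u y) x = k * circle_mean r v u x.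
Proof.
move=> /circle_integrand_continuous c1.
rewrite /circle_mean mulrCA; congr (_ * _).
have <- := cintZ 0 (2 * pi) k c1.
by apply: eq_cint => t; ring.
Qed.

Lemma eq_circle_mean r v u1 u2 x :
  (forall t, u1 (x + circ r t *: v) = u2 (x + circ r t *: v)) -> u1 x = u2 x ->
  circle_mean r v u1 x = circle_mean r v u2 x.
Proof.
move=> ut ux; rewrite /circle_mean; congr (_ * _).
by apply: eq_cint => t; rewrite ut ux.
Qed.

(** Cauchy's estimate on a circle of radius [rho / 4] for directions of norm at most 1, then
    homogeneity. *)
Lemma diff_bound f x0 (rho M : R) : 0 < rho ->
  (forall h, rnorm h < rho -> differentiable f (x0 + h)) ->
  (forall h, rnorm h < rho -> rnorm (f (x0 + h)) <= M) ->
  forall h v, rnorm h <= rho / 2 ->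
    rnorm ('d f (x0 + h) v) <= 16 * M / rho * rnorm v.
Proof.
move=> rho0 df fM h v hr.
have M0 : 0 <= M by have := fM 0; rewrite rnorm0 => /(_ rho0); apply: le_trans (rnorm_ge0 _).
have unit w : rnorm w <= 1 -> rnorm ('d f (x0 + h) w) <= 16 * M / rho.
  move=> w1.
  have q0 : 0 < rho / 4 by rewrite divr_gt0.
  (* Cauchy's formula needs room beyond the circle of radius [rho / 4]: with [3 / 8 * rho] one still
     has [1/2 + 3/8 < 1]. *)
  have inb (k : C) : rnorm k <= 3 / 8 * rho -> rnorm (h + k *: w) < rho.
    move=> kr; apply: le_lt_trans (rnormD _ _) _; rewrite rnormZ.
    have := rnorm_ge0 k; have := rnorm_ge0 w; nra.
  have -> : 'd f (x0 + h) w = circle_mean (rho / 4) w f (x0 + h).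
    rewrite (@cauchy_circle_mean _ _ _ _ (3 / 8 * rho)).
    - by rewrite deriveE//; apply: df; lra.
    - by rewrite q0; lra.
    - by move=> k kr; rewrite -addrA; apply/df/inb.
  have -> : 16 * M / rho = 4 * M / (rho / 4) by field; rewrite gt_eqF.
  apply: circle_mean_bound => // [t|t|].
  - apply: differentiable_continuous; rewrite -addrA; apply/df/inb.
    by rewrite rnorm_circ//; lra.
  - by rewrite -addrA; apply/fM/inb; rewrite rnorm_circ//; lra.
  - by apply: fM; lra.
have [->|v0] := eqVneq v 0; first by rewrite linear0 !rnorm0 mulr0.
have nv : 0 < rnorm v by rewrite lt_neqAle rnorm_ge0 eq_sym rnorm_eq0 v0.
have := unit ((rnorm v)^-1%:C *: v); rewrite linearZ/= rnormZ rnormM rnormR.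
rewrite gtr0_norm ?invr_gt0// mulVf ?gt_eqF// => /(_ (lexx _)).
by rewrite ler_pdivrMl// mulrC.
Qed.

Lemma rnorm_is_derive (g : R -> R) (x l : R) :
  (forall e : R, 0 < e -> exists2 d : R, 0 < d & forall h : R, `|h| < d ->
    `|g (x + h) - g x - l * h| <= e * `|h|) -> is_derive x 1 g l.
Proof.
move=> gl.
suff H : (fun s : R => s^-1 *: (g (s *: 1 + x) - g x)) @ 0^' --> l.
  by split; [apply/cvg_ex; exists l|exact/cvg_lim].
apply/cvgrPdist_le => e /gl[d d0 dP].
apply/nbhs_ballP; exists d => // s; rewrite /ball/= sub0r normrN => /dP H s0.
rewrite /GRing.scale/= mulr1 [s + x]addrC.
rewrite distrC -(ler_pM2r (_ : 0 < `|s|)) ?normr_gt0// -normrM.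
by rewrite mulrBl [s^-1 * _]mulrC mulfVK.
Qed.

(** The real mean value theorem on [t |-> f (x + t w)], once for the real and once for the imaginary
    part, whence the 2; [T] stands for either part. *)
Lemma diff_mean_value f x w (K : R) :
  (forall t : R, 0 <= t <= 1 -> differentiable f (x + t%:C *: w)) ->
  (forall t : R, 0 <= t <= 1 -> rnorm ('d f (x + t%:C *: w) w) <= K) ->
  rnorm (f (x + w) - f x) <= 2 * K.
Proof.
move=> df dK.
have K0 : 0 <= K by apply: le_trans (rnorm_ge0 _) (dK 0 _); rewrite lexx ler01.
suff H (T : {additive C -> R}) :
    (forall z, `|T z| <= rnorm z) -> (forall (a : R) z, T (a%:C * z) = a * T z) ->
    `|T (f (x + w) - f x)| <= K.
  apply: le_trans (rnorm_le_ReIm _) _.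
  have ReZ (a : R) (z : C) : complex.Re (a%:C * z) = a * complex.Re z.
    by case: z => p q /=; rewrite mul0r subr0.
  have ImZ (a : R) (z : C) : complex.Im (a%:C * z) = a * complex.Im z.
    by case: z => p q /=; rewrite mul0r addr0.
  have := H (@complex.Re R) (@Re_le_rnorm R) ReZ.
  have := H (@complex.Im R) (@Im_le_rnorm R) ImZ.
  by move=> /= H1 H2; lra.
move=> T1 TZ.
pose g t := T (f (x + t%:C *: w)).
pose dg t := T ('d f (x + t%:C *: w) w).
have gd (t : R) : 0 <= t <= 1 -> is_derive t 1 g (dg t).
  move=> t01; apply: rnorm_is_derive => e e0.
  have w1 : 0 < rnorm w + 1 by rewrite ltr_wpDl// rnorm_ge0.
  have [d d0 dP] := differentiable_rnorm (df t t01) (divr_gt0 e0 w1).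
  exists (d / (rnorm w + 1)) => [|h]; first by rewrite divr_gt0.
  rewrite ltr_pdivlMr// => hd.
  have := dP (h%:C *: w); rewrite rnormZ rnormR linearZ.
  have h0 := normr_ge0 h; have w0 := rnorm_ge0 w.
  move=> /(_ ltac:(nra)) H.
  have -> : g (t + h) - g t - dg t * h =
      T (f (x + t%:C *: w + h%:C *: w) - f (x + t%:C *: w)
         - h%:C * 'd f (x + t%:C *: w) w).
    by rewrite !raddfB/= TZ [h * _]mulrC /g raddfD/= scalerDl addrA.
  apply: le_trans (T1 _) _; apply: le_trans H _.
  rewrite mulrAC ler_pdivrMr// -mulrA; apply: ler_wpM2l; first exact: ltW.
  by rewrite ler_wpM2l// lerDl.
have gc : {within `[0, 1], continuous g}.
  apply: continuous_in_subspaceT => t; rewrite inE/= in_itv/= => /gd gdt.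
  by apply/differentiable_continuous/derivable1_diffP; exact: ex_derive.
have g01 (t : R) : t \in `]0, 1[%R -> is_derive t 1 g (dg t).
  by rewrite in_itv/= => /andP[/ltW t0 /ltW t1]; apply: gd; rewrite t0.
have [t] := MVT_segment ler01 g01 gc.
rewrite in_itv/= => t01; rewrite /g subr0 mulr1 scale1r scale0r addr0 -raddfB => ->.
by apply: le_trans (T1 _) _; exact: dK.
Qed.

Lemma holomorphic_lipschitz f x0 (rho M : R) : 0 < rho ->
  (forall h, rnorm h < rho -> differentiable f (x0 + h)) ->
  (forall h, rnorm h < rho -> rnorm (f (x0 + h)) <= M) ->
  forall h w, rnorm h <= rho / 4 -> rnorm w <= rho / 4 ->
    rnorm (f (x0 + h + w) - f (x0 + h)) <= 32 * M / rho * rnorm w.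
Proof.
move=> rho0 df fM h w hr wr.
have inb (t : R) : 0 <= t <= 1 -> rnorm (h + t%:C *: w) <= rho / 2.
  move=> /andP[t0 t1]; apply: le_trans (rnormD _ _) _; rewrite rnormZ rnormR ger0_norm//.
  by have := rnorm_ge0 w; nra.
have -> : 32 * M / rho * rnorm w = 2 * (16 * M / rho * rnorm w) by ring.
apply: diff_mean_value => t /inb tr; rewrite -addrA; first by apply: df; lra.
exact: diff_bound.
Qed.

Lemma is_diff_apply f (df : V -> C) x : is_diff x f df -> forall v, 'd f x v = df v.
Proof. by move=> D v; exact: (congr1 (fun g : V -> C => g v) (@diff_val _ _ _ _ _ _ _ D)). Qed.

Lemma second_bound_ge0 (rho M : R) : 0 < rho -> 0 <= M ->
  0 <= 16 * (32 * M / rho) / (rho / 4).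
Proof.
move=> /ltW r0 M0; apply: divr_ge0; last exact: divr_ge0.
by apply: mulr_ge0 => //; apply: divr_ge0 => //; exact: mulr_ge0.
Qed.

(** Cauchy's estimate on the ball of radius [rho / 4] for the increment [f (y + w) - f y], which is
    already of size [rnorm w] by [holomorphic_lipschitz]. *)
Lemma diff_lipschitz f x0 (rho M : R) : 0 < rho ->
  (forall h, rnorm h < rho -> differentiable f (x0 + h)) ->
  (forall h, rnorm h < rho -> rnorm (f (x0 + h)) <= M) ->
  forall h w v, rnorm h <= rho / 8 -> rnorm w <= rho / 4 ->
    rnorm ('d f (x0 + h + w) v - 'd f (x0 + h) v)
      <= 16 * (32 * M / rho) / (rho / 4) * rnorm w * rnorm v.
Proof.
move=> rho0 df fM h w v hr wr.
pose F y := f (y + w) - f y.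
have shiftw y : differentiable f (y + w) -> is_diff y (fun y => f (y + w)) ('d f (y + w)).
  move=> dfy.
  have dw : is_diff y (fun y => y + w) id.
    by apply: is_diff_eq; rewrite addr0.
  have dfw : is_diff (y + w) f ('d f (y + w)) by exact: differentiableP.
  exact: (@is_diff_comp _ _ _ _ (fun y => y + w) _ f).
have dF y : differentiable f (y + w) -> differentiable f y ->
    is_diff y F ('d f (y + w) \- 'd f y).
  move=> d1 d2; have := shiftw _ d1; have := differentiableP d2 => ? ?.
  exact: is_diffB.
have inb k : rnorm k < rho / 4 -> rnorm (k + w) < rho.
  by move=> kr; apply: le_lt_trans (rnormD _ _) _; lra.
have dFb k : rnorm k < rho / 4 -> is_diff (x0 + k) F ('d f (x0 + k + w) \- 'd f (x0 + k)).
  move=> kr; apply: dF; last by apply: df; lra.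
  by rewrite -addrA; exact/df/inb.
have -> : 'd f (x0 + h + w) v - 'd f (x0 + h) v = 'd F (x0 + h) v.
  have /dFb D : rnorm h < rho / 4 by lra.
  exact: (esym (is_diff_apply D v)).
have r4 : 0 < rho / 4 by rewrite divr_gt0.
have -> : 16 * (32 * M / rho) / (rho / 4) * rnorm w = 16 * (32 * M / rho * rnorm w) / (rho / 4).
  by ring.
apply: (diff_bound r4); last by lra.
  by move=> k /dFb[].
by move=> k /ltW kr; exact: (holomorphic_lipschitz rho0 df fM).
Qed.

(** Mean value inequality for [f] minus its differential at [x0 + h]: the derivative of that
    difference along the segment is controlled by [diff_lipschitz]. *)
Lemma taylor_bound f x0 (rho M : R) : 0 < rho ->
  (forall h, rnorm h < rho -> differentiable f (x0 + h)) ->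
  (forall h, rnorm h < rho -> rnorm (f (x0 + h)) <= M) ->
  forall h w, rnorm h <= rho / 8 -> rnorm w <= rho / 4 ->
    rnorm (f (x0 + h + w) - f (x0 + h) - 'd f (x0 + h) w)
      <= 2 * (16 * (32 * M / rho) / (rho / 4)) * rnorm w ^+ 2.
Proof.
move=> rho0 df fM h w hr wr.
have M0 : 0 <= M by have := fM 0; rewrite rnorm0 => /(_ rho0); apply: le_trans (rnorm_ge0 _).
have dfh : differentiable f (x0 + h) by apply: df; lra.
pose A : {linear V -> C} := 'd f (x0 + h).
pose F y := f y - A y.
have cA : continuous A by exact: diff_continuous.
have dF y : differentiable f y -> is_diff y F ('d f y \- A).
  move=> d1; have ? := differentiableP d1.
  have ? : is_diff y A A by apply: DiffDef; [exact: linear_differentiable|exact: diff_lin].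
  exact: is_diffB.
have -> : f (x0 + h + w) - f (x0 + h) - A w = F (x0 + h + w) - F (x0 + h).
  by rewrite /F (raddfD A (x0 + h)) /=; ring.
have -> : 2 * (16 * (32 * M / rho) / (rho / 4)) * rnorm w ^+ 2 =
  2 * (16 * (32 * M / rho) / (rho / 4) * rnorm w * rnorm w) by ring.
have tw (t : R) : 0 <= t <= 1 -> rnorm (t%:C *: w) <= rnorm w.
  move=> /andP[t0 t1]; rewrite rnormZ rnormR ger0_norm// ler_piMl// rnorm_ge0//.
have inb (t : R) : 0 <= t <= 1 -> differentiable f (x0 + h + t%:C *: w).
  move=> /tw tr; rewrite -addrA; apply: df.
  by apply: le_lt_trans (rnormD _ _) _; lra.
apply: diff_mean_value => t t01; first by case: (dF _ (inb t t01)).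
have D := dF _ (inb t t01).
have -> := is_diff_apply D w.
have L0 := second_bound_ge0 rho0 M0.
apply: le_trans (diff_lipschitz rho0 df fM w hr _) _; first by have := tw t t01; lra.
apply: ler_wpM2r; first exact: rnorm_ge0.
by apply: ler_wpM2l => //; exact: tw.
Qed.

(* The derivative of [D_v f] is obtained by differentiating the Cauchy formula
   for [D_v f] under the integral sign, the second order Taylor bound
   controlling the remainder uniformly on the circle. *)
Lemma derive_circle_mean f x0 v (rho M : R) : 0 < rho ->
  (forall h, rnorm h < rho -> differentiable f (x0 + h)) ->
  (forall h, rnorm h < rho -> rnorm (f (x0 + h)) <= M) ->
  forall r, 0 < r -> r * rnorm v < rho / 16 ->
  differentiable ('D_v f) x0 /\
  forall w, 'd ('D_v f) x0 w = circle_mean r v ('D_w f) x0.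
Proof.
move=> rho0 df fM r r0 rv.
have M0 : 0 <= M by have := fM 0; rewrite rnorm0 => /(_ rho0); apply: le_trans (rnorm_ge0 _).
pose L := 16 * (32 * M / rho) / (rho / 4).
have L0 : 0 <= L := second_bound_ge0 rho0 M0.
have dE h w : rnorm h < rho -> 'D_w f (x0 + h) = 'd f (x0 + h) w.
  by move=> hr; rewrite deriveE//; exact: df.
have small k : rnorm k < rho / 16 -> rnorm k < rho by lra.
have cr t : rnorm (circ r t *: v) < rho / 16 by rewrite rnormZ rnorm_circ.
have cont w h : rnorm h < rho / 16 -> {for x0 + h, continuous (fun y => 'd f y w)}.
  move=> hr; apply/continuous_rnormP => e e0.
  have K0 : 0 < L * rnorm w + 1 by rewrite ltr_wpDl// mulr_ge0// rnorm_ge0.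
  exists (Num.min (rho / 4) (e / (L * rnorm w + 1))).
    by rewrite lt_min !divr_gt0.
  move=> k; rewrite lt_min => /andP[/ltW kr]; rewrite ltr_pdivlMr// => ke.
  apply: le_lt_trans (diff_lipschitz rho0 df fM w _ kr) _; first by lra.
  by apply: le_lt_trans ke; rewrite -/L; have := rnorm_ge0 k; nra.
have cont_c w t : {for x0 + circ r t *: v, continuous (fun y => 'd f y w)}.
  exact: cont.
have AD : linear (fun w => circle_mean r v (fun y => 'd f y w) x0).
  move=> a w1 w2.
  have -> : circle_mean r v (fun y => 'd f y (a *: w1 + w2)) x0 =
            circle_mean r v (fun y => a * 'd f y w1 + 'd f y w2) x0.
    by apply: eq_circle_mean => [t|]; rewrite linearP.
  have c1 t : {for x0 + circ r t *: v, continuous (fun y => a * 'd f y w1)}.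
    have := cont_c w1 t => c1.
    exact: (@continuousM _ _ (fun=> a) (fun y => 'd f y w1) _ (@cvg_cst _ _ _ _ _) c1).
  have -> := circle_meanD c1 (cont_c w2).
  by have -> := circle_meanZ a (cont_c w1).
(* The candidate derivative: Cauchy's formula for ['D_v f] differentiated in direction [w] under the
   integral sign. *)
pose A : {linear V -> C} := HB.pack (fun w => circle_mean r v (fun y => 'd f y w) x0)
  (GRing.isLinear.Build _ _ _ _ _ AD).
have AK w : rnorm (A w) <= 4 * (16 * M / rho) / r * rnorm w.
  have -> : 4 * (16 * M / rho) / r * rnorm w = 4 * (16 * M / rho * rnorm w) / r by ring.
  apply: circle_mean_bound => // [t|].
    by apply: (diff_bound rho0 df fM); have := cr t; lra.
  by have := diff_bound rho0 df fM (h := 0) w; rewrite addr0 rnorm0; apply; lra.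
have [dD dDE] : differentiable ('D_v f) x0 /\ 'd ('D_v f) x0 = A :> (V -> C).
  apply: (rnorm_differentiable AK) => e e0.
  pose K := 4 * (2 * (16 * (32 * M / rho) / (rho / 4))) / r.
  have K0 : 0 <= K.
    apply: divr_ge0; last exact: ltW.
    by apply: mulr_ge0 => //; apply: mulr_ge0 => //; exact: second_bound_ge0.
  have K1 : 0 < K + 1 by rewrite ltr_wpDl.
  exists (Num.min (rho / 16) (e / (K + 1))); first by rewrite lt_min !divr_gt0.
  move=> w; rewrite lt_min => /andP[wr]; rewrite ltr_pdivlMr// => we.
  (* The room required by Cauchy's formula: radius [2 * r] is still safe, because
     [2 * r * rnorm v < rho / 8]. *)
  have rr : 0 < r < 2 * r by lra.
  have inb (k : C) : rnorm k <= 2 * r -> rnorm (k *: v) < rho / 8.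
    by move=> kr; rewrite rnormZ; have := rnorm_ge0 v; nra.
  have E1 : 'D_v f (x0 + w) = circle_mean r v f (x0 + w).
    rewrite (cauchy_circle_mean rr)// => k /inb kr; rewrite -addrA; apply: df.
    by apply: le_lt_trans (rnormD _ _) _; lra.
  have E2 : 'D_v f x0 = circle_mean r v f x0.
    by rewrite (cauchy_circle_mean rr)// => k /inb kr; apply: df; lra.
  (* By linearity of the mean and translation of its base point, the error in the derivative of
     ['D_v f] is the circle mean of this remainder, which is quadratic in [w] uniformly on the
     circle. *)
  pose T y := f (y + w) - f y - 'd f y w.
  have cf h : rnorm h < rho -> {for x0 + h, continuous f}.
    by move=> /df; exact: differentiable_continuous.
  have cw t : {for x0 + circ r t *: v, continuous (fun y => f (y + w))}.
    apply/continuous_rnormP => e' e'0.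
    have hw : rnorm (circ r t *: v + w) < rho.
      by apply: le_lt_trans (rnormD _ _) _; have := cr t; lra.
    have [d d0 dP] := (continuous_rnormP _ _).1 (cf _ hw) _ e'0.
    by exists d => // k /dP; rewrite addrA (addrAC _ w).
  have c1 t : {for x0 + circ r t *: v, continuous f} by exact/cf/small.
  have cmul u t : {for x0 + circ r t *: v, continuous u} ->
      {for x0 + circ r t *: v, continuous (fun y => -1 * u y)}.
    move=> cu.
    exact: (@continuousM _ _ (fun=> -1) u _ (@cvg_cst _ _ _ _ _) cu).
  have E3 : 'D_v f (x0 + w) - 'D_v f x0 - A w = circle_mean r v T x0.
    have -> : circle_mean r v T x0 =
        circle_mean r v (fun y => f (y + w) + (-1 * f y + -1 * 'd f y w)) x0.
      by apply: eq_circle_mean => [t|]; rewrite /T; ring.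
    have cm1 t := cmul _ _ (c1 t); have cm2 t := cmul _ _ (cont_c w t).
    have cm12 t : {for x0 + circ r t *: v,
        continuous (fun y => -1 * f y + -1 * 'd f y w)}.
      exact: (continuousD (cm1 t) (cm2 t)).
    have -> := circle_meanD cw cm12; have -> := circle_meanD cm1 cm2.
    have -> := circle_meanZ (-1) c1; have -> := circle_meanZ (-1) (cont_c w).
    rewrite E1 E2.
    have -> : circle_mean r v f (x0 + w) = circle_mean r v (fun y => f (y + w)) x0.
      by congr (_ * _); apply: eq_cint => t; rewrite addrAC.
    by rewrite /A /=; ring.
  rewrite E3.
  have TB k : rnorm k < rho / 16 ->
      rnorm (T (x0 + k)) <= 2 * (16 * (32 * M / rho) / (rho / 4)) * rnorm w ^+ 2.
    move=> kr; have k8 : rnorm k <= rho / 8 by lra.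
    have w4 : rnorm w <= rho / 4 by lra.
    exact: (taylor_bound rho0 df fM k8 w4).
  apply: le_trans (_ : K * rnorm w ^+ 2 <= _).
    have -> : K * rnorm w ^+ 2 = 4 * (2 * (16 * (32 * M / rho) / (rho / 4)) * rnorm w ^+ 2) / r.
      by rewrite /K; ring.
    have cT t : {for x0 + circ r t *: v, continuous T}.
      exact: (continuousB (continuousB (cw t) (c1 t)) (cont_c w t)).
    have := TB 0; rewrite addr0 rnorm0 => /(_ (divr_gt0 rho0 (ltr0n _ 16))) T0.
    exact: (circle_mean_bound r0 cT (fun t => TB _ (cr t)) T0).
  (* The quadratic error [K * rnorm w ^+ 2] is at most [e * rnorm w] by the choice of
     [e / (K + 1)]. *)
  rewrite expr2 mulrA; apply: ler_wpM2r; first exact: rnorm_ge0.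
  by have := rnorm_ge0 w; nra.
split=> // w; rewrite dDE /A /=; apply: eq_circle_mean => [t|].
  by rewrite dE//; exact: small.
by have := dE 0 w; rewrite addr0 rnorm0 => ->.
Qed.

Lemma open_rnorm_ball (U : set V) x : open U -> U x ->
  exists2 rho : R, 0 < rho & forall h, rnorm h < rho -> U (x + h).
Proof. by move=> oU Ux; apply/near_rnormP; exact: open_nbhs_nbhs. Qed.

Lemma holomorphic_local_bound f (U : set V) x : open U -> U x ->
  holomorphic_on U f -> exists rho M : R, [/\ 0 < rho,
    forall h, rnorm h < rho -> U (x + h) &
    forall h, rnorm h < rho -> rnorm (f (x + h)) <= M].
Proof.
move=> oU Ux hf; have [d d0 dP] := open_rnorm_ball oU Ux.
have [e e0 eP] := (continuous_rnormP f x).1 (differentiable_continuous (hf _ Ux)) _ ltr01.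
exists (Num.min d e), (rnorm (f x) + 1); split=> [|h|h].
- by rewrite lt_min d0.
- by rewrite lt_min => /andP[/dP].
- rewrite lt_min => /andP[_ /eP H].
  have := rnormD (f (x + h) - f x) (f x); rewrite subrK; lra.
Qed.

Theorem holomorphic_derive f (U : set V) v : open U ->
  holomorphic_on U f -> holomorphic_on U ('D_v f).
Proof.
move=> oU hf x Ux; have [rho [M [rho0 hU hM]]] := holomorphic_local_bound oU Ux hf.
have v1 : 0 < rnorm v + 1 by rewrite ltr_wpDl// rnorm_ge0.
apply: (derive_circle_mean rho0 (fun h hr => hf _ (hU h hr)) hM
  (r := rho / 32 / (rnorm v + 1)) _ _).1; first by rewrite !divr_gt0.
rewrite mulrAC ltr_pdivrMr//; have := rnorm_ge0 v; nra.
Qed.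

(** The derivative of ['D_v f] along [w] is the circle mean along [v] of ['D_w f]; since ['D_w f] is
    itself holomorphic, Cauchy's formula identifies that mean with ['D_v ('D_w f)]. *)
Theorem derive_comm f (U : set V) v w x : open U -> holomorphic_on U f -> U x ->
  'D_w ('D_v f) x = 'D_v ('D_w f) x.
Proof.
move=> oU hf Ux; have [rho [M [rho0 hU hM]]] := holomorphic_local_bound oU Ux hf.
have v1 : 0 < rnorm v + 1 by rewrite ltr_wpDl// rnorm_ge0.
pose r := rho / 32 / (rnorm v + 1).
have r0 : 0 < r by rewrite !divr_gt0.
have rv : r * rnorm v < rho / 16.
  by rewrite /r mulrAC ltr_pdivrMr//; have := rnorm_ge0 v; nra.
have [D DE] := derive_circle_mean rho0 (fun h hr => hf _ (hU h hr)) hM r0 rv.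
have E := deriveE w D.
apply: (etrans E).
apply: (etrans (DE w)).
have rr : 0 < r < 2 * r by clear -r0; lra.
apply: (cauchy_circle_mean rr) => k kr.
apply: (holomorphic_derive w oU hf).
apply: hU.
rewrite rnormZ.
have := rnorm_ge0 v; nra.
Qed.

End HolomorphicDerivative.

(** * Calculus of matrix-valued functions *)

Section MatrixCalculus.
Context (R : realType) (V : normedModType R[i]).
Local Notation C := R[i].

(** Fields are total functions that are constrained only on [U]; openness makes their values
    elsewhere irrelevant. *)
Lemma holomorphic_on_eq (W : normedModType C) (U : set V) (f g : V -> W) :
  open U -> (forall x, U x -> f x = g x) -> holomorphic_on U f -> holomorphic_on U g.
Proof.
move=> oU fg hf x Ux.
have [rho rho0 hU] := open_rnorm_ball oU Ux.
have [K K0 KP] := linear_continuous_bounded (diff_continuous (hf x Ux)).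
apply: (rnorm_differentiable KP _).1 => e /(differentiable_rnorm (hf x Ux))[d d0 dP].
exists (Num.min d rho); first by rewrite lt_min d0.
by move=> h; rewrite lt_min => /andP[/dP H /hU Uh]; rewrite -!fg.
Qed.

Lemma derive_eq_open (W : normedModType C) (U : set V) (f g : V -> W) x v :
  open U -> (forall x, U x -> f x = g x) -> U x -> 'D_v f x = 'D_v g x.
Proof.
move=> oU fg Ux; apply: near_eq_derive.
by apply: (@filterS _ _ _ U); [move=> y /fg|exact: open_nbhs_nbhs].
Qed.

Lemma derive_dirD (W : normedModType C) (f : V -> W) x u v : differentiable f x ->
  'D_(u + v) f x = 'D_u f x + 'D_v f x.
Proof. by move=> df; rewrite !deriveE// linearD. Qed.

Lemma derive_dirZ (W : normedModType C) (f : V -> W) x (a : C) u : differentiable f x ->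
  'D_(a *: u) f x = a *: 'D_u f x.
Proof. by move=> df; rewrite !deriveE// linearZ. Qed.

Lemma differentiable_sumT (W : normedModType C) (I : finType) (F : I -> V -> W) x :
  (forall i, differentiable (F i) x) -> differentiable (fun y => \sum_i F i y) x.
Proof.
move=> dF; have -> : (fun y => \sum_i F i y) = \sum_i F i.
  by apply/funext => y; rewrite fct_sumE.
elim/big_rec: _ => [|i G _ dG]; first exact: differentiable_cst.
exact: differentiableD.
Qed.

Lemma derive_sumT (W : normedModType C) (I : finType) (F : I -> V -> W) x v :
  (forall i, differentiable (F i) x) ->
  'D_v (fun y => \sum_i F i y) x = \sum_i 'D_v (F i) x.
Proof.
move=> dF; have -> : (fun y => \sum_i F i y) = \sum_i F i.
  by apply/funext => y; rewrite fct_sumE.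
suff [_ ->] : differentiable (\sum_i F i) x /\
    'D_v (\sum_i F i) x = \sum_i 'D_v (F i) x by [].
elim/big_rec2: _ => [|i G H _ [dG <-]].
  by split; [exact: differentiable_cst|exact: derive_cst].
by split; [exact: differentiableD|rewrite deriveD//; exact: diff_derivable].
Qed.

Lemma differentiable_mxP p q (F : V -> 'M[C]_(p, q)) x :
  differentiable F x <-> forall i j, differentiable (fun y => F y i j) x.
Proof.
split=> [dF i j|dF].
  apply: (@differentiable_comp _ _ _ _ F (fun M : 'M[C]_(p, q) => M i j)) => //.
  exact: differentiable_coord.
have -> : F = fun y => \sum_i \sum_j F y i j *: delta_mx i j.
  by apply/funext => y; exact: matrix_sum_delta.
by apply: differentiable_sumT => i; apply: differentiable_sumT => j; exact: differentiableZl.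
Qed.

Lemma derive_entry p q (F : V -> 'M[C]_(p, q)) x v i j : differentiable F x ->
  'D_v F x i j = 'D_v (fun y => F y i j) x.
Proof.
move=> dF; pose c (M : 'M[C]_(p, q)) := M i j.
have lc : linear c by move=> a A B; rewrite /c !mxE.
pose L : {linear 'M[C]_(p, q) -> C} := HB.pack c (GRing.isLinear.Build _ _ _ _ _ lc).
have dc : differentiable c (F x) by exact: differentiable_coord.
have dcF : differentiable (c \o F) x by exact: differentiable_comp.
rewrite (deriveE v dF).
have -> : 'D_v (fun y => F y i j) x = 'd (c \o F) x v by exact: deriveE.
have cL : continuous L by move=> M; apply/differentiable_continuous/differentiable_coord.
have E1 := congr1 (fun g : V -> C => g v) (diff_comp dF dc).
have E2 := congr1 (fun g : _ -> C => g ('d F x v)) (diff_lin (F x) cL).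
exact: (esym (etrans E1 E2)).
Qed.

Lemma differentiable_mulmx p q r (A : V -> 'M[C]_(p, q)) (B : V -> 'M[C]_(q, r)) x :
  differentiable A x -> differentiable B x -> differentiable (fun y => A y *m B y) x.
Proof.
move=> /differentiable_mxP dA /differentiable_mxP dB; apply/differentiable_mxP => i j.
under eq_fun do rewrite mxE.
by apply: differentiable_sumT => k; exact: differentiableM.
Qed.

Lemma derive_mulmx p q r (A : V -> 'M[C]_(p, q)) (B : V -> 'M[C]_(q, r)) x v :
  differentiable A x -> differentiable B x ->
  'D_v (fun y => A y *m B y) x = 'D_v A x *m B x + A x *m 'D_v B x.
Proof.
move=> dA dB; apply/matrixP => i j.
rewrite derive_entry; last exact: differentiable_mulmx.
under eq_fun do rewrite mxE.
have dAe := (differentiable_mxP _ _).1 dA; have dBe := (differentiable_mxP _ _).1 dB.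
rewrite derive_sumT; last by move=> k; exact: differentiableM.
rewrite !mxE -big_split/=; apply: eq_bigr => k _.
rewrite !derive_entry//.
rewrite (@deriveM _ _ (fun y => A y i k) (fun y => B y k j)); try exact: diff_derivable.
by rewrite /GRing.scale/= addrC; congr (_ + _); rewrite mulrC.
Qed.

Lemma differentiable_scale_mx p q (f : V -> C) (A : V -> 'M[C]_(p, q)) x :
  differentiable f x -> differentiable A x -> differentiable (fun y => f y *: A y) x.
Proof.
move=> df /differentiable_mxP dA; apply/differentiable_mxP => i j.
under eq_fun do rewrite mxE.
exact: differentiableM.
Qed.

Lemma derive_scale_mx p q (f : V -> C) (A : V -> 'M[C]_(p, q)) x v :
  differentiable f x -> differentiable A x ->
  'D_v (fun y => f y *: A y) x = 'D_v f x *: A x + f x *: 'D_v A x.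
Proof.
move=> df dA; apply/matrixP => i j.
rewrite derive_entry; last exact: differentiable_scale_mx.
under eq_fun do rewrite mxE.
have dAe := (differentiable_mxP _ _).1 dA.
rewrite !mxE !derive_entry//.
rewrite (@deriveM _ _ f (fun y => A y i j)); try exact: diff_derivable.
by rewrite /GRing.scale/= addrC; congr (_ + _); rewrite mulrC.
Qed.

End MatrixCalculus.

Section DirectionalDerivative.
Context (R : realType) (m : nat).
Local Notation C := R[i].
Local Notation V := 'rV[C]_m.

Lemma derive_coord_sum p q (F : V -> 'M[C]_(p, q)) x v : differentiable F x ->
  'D_v F x = \sum_j v 0 j *: 'D_(delta_mx 0 j) F x.
Proof.
move=> dF; rewrite deriveE// [in LHS](row_sum_delta v) linear_sum.
by apply: eq_bigr => j _; rewrite linearZ deriveE.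
Qed.

Lemma holomorphic_derive_mx p q (U : set V) (F : V -> 'M[C]_(p, q)) v : open U ->
  holomorphic_on U F -> holomorphic_on U ('D_v F).
Proof.
move=> oU hF x Ux; apply/differentiable_mxP => i j.
have hFij : holomorphic_on U ('D_v (fun y => F y i j)).
  apply: holomorphic_derive => // y Uy; have /differentiable_mxP := hF y Uy; exact.
apply: (holomorphic_on_eq oU _ hFij) => // y Uy.
by rewrite derive_entry//; exact: hF.
Qed.

(** The direction varies with the point, so the derivative is first expanded in constant coordinate
    directions. *)
Lemma holomorphic_derive_along p q (U : set V) (F : V -> 'M[C]_(p, q)) (u : V -> V) :
  open U -> holomorphic_on U F -> holomorphic_on U u ->
  holomorphic_on U (fun x => 'D_(u x) F x).
Proof.
move=> oU hF hu.
apply: (holomorphic_on_eq (f := fun x => \sum_j u x 0 j *: 'D_(delta_mx 0 j) F x) oU).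
  by move=> x Ux; rewrite -derive_coord_sum//; exact: hF.
move=> x Ux; apply: differentiable_sumT => j; apply: differentiable_scale_mx.
  by have /differentiable_mxP := hu x Ux; exact.
exact: (holomorphic_derive_mx _ oU hF).
Qed.

End DirectionalDerivative.

(** * Linear algebra in the frame *)

Section Frame.
Context (R : realType) (n : nat).
Local Notation C := R[i].
Local Notation X := 'rV[C]_(n + n).
Local Notation rV := 'rV[C]_n.
Variables (N : X -> 'M[C]_n) (om : 'M[C]_n).
Implicit Types (x a c : X) (al be : rV).

(* (al, be) are the coefficients in the frame (v_j), (h_j); [N x] is the matrix
   of vertical components of the h_j. *)
Definition frame x al be : X := row_mx be (al + be *m N x).
Definition vert x a : rV := rsubmx a - lsubmx a *m N x.

Lemma vert_frame x al be : vert x (frame x al be) = al.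
Proof. by rewrite /vert /frame row_mxKr row_mxKl addrK. Qed.

Lemma lsubmx_frame x al be : lsubmx (frame x al be) = be.
Proof. by rewrite /frame row_mxKl. Qed.

Lemma frame_vert x a : frame x (vert x a) (lsubmx a) = a.
Proof. by rewrite /frame /vert subrK hsubmxK. Qed.

Lemma frameP x (k : C) al1 be1 al2 be2 :
  frame x (k *: al1 + al2) (k *: be1 + be2) =
  k *: frame x al1 be1 + frame x al2 be2.
Proof.
rewrite /frame scale_row_mx add_row_mx mulmxDl -scalemxAl; congr row_mx.
by rewrite scalerDr addrACA.
Qed.

Lemma frameD x al1 be1 al2 be2 :
  frame x (al1 + al2) (be1 + be2) = frame x al1 be1 + frame x al2 be2.
Proof. by have := frameP x 1 al1 be1 al2 be2; rewrite !scale1r. Qed.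

Lemma frame0 x : frame x 0 0 = 0.
Proof. by rewrite /frame mul0mx addr0 row_mx0. Qed.

Lemma frameZ x k al be : frame x (k *: al) (k *: be) = k *: frame x al be.
Proof. by have := frameP x k al be 0 0; rewrite !addr0 frame0 addr0. Qed.

Lemma frameN x al be : frame x (- al) (- be) = - frame x al be.
Proof. by have := frameZ x (-1) al be; rewrite !scaleN1r. Qed.

Lemma lsubmx_linear : linear (lsubmx : X -> rV).
Proof. by move=> k a c; rewrite linearP. Qed.

Lemma vert_linear x : linear (vert x).
Proof.
move=> k a c; rewrite /vert lsubmx_linear (linearP rsubmx) mulmxDl -scalemxAl scalerBr.
by rewrite opprD addrACA.
Qed.

Lemma vertD x a c : vert x (a + c) = vert x a + vert x c.
Proof. by have := vert_linear x 1 a c; rewrite !scale1r. Qed.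

Lemma vert0 x : vert x 0 = 0.
Proof. by rewrite /vert !linear0 mul0mx subr0. Qed.

Lemma vertZ x k a : vert x (k *: a) = k *: vert x a.
Proof. by have := vert_linear x k a 0; rewrite vert0 !addr0. Qed.

Definition pairing al be : C := (al *m om *m be^T) 0 0.

Lemma pairingDl al1 al2 be : pairing (al1 + al2) be = pairing al1 be + pairing al2 be.
Proof. by rewrite /pairing !mulmxDl mxE. Qed.

Lemma pairingDr al be1 be2 : pairing al (be1 + be2) = pairing al be1 + pairing al be2.
Proof. by rewrite /pairing linearD mulmxDr mxE. Qed.

Lemma pairingZl k al be : pairing (k *: al) be = k * pairing al be.
Proof. by rewrite /pairing -!scalemxAl mxE. Qed.

Lemma pairingZr k al be : pairing al (k *: be) = k * pairing al be.
Proof. by rewrite /pairing linearZ -scalemxAr mxE. Qed.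

Lemma pairingNl al be : pairing (- al) be = - pairing al be.
Proof. by rewrite -scaleN1r pairingZl mulN1r. Qed.

Lemma pairingNr al be : pairing al (- be) = - pairing al be.
Proof. by rewrite -scaleN1r pairingZr mulN1r. Qed.

Lemma pairing0l be : pairing 0 be = 0.
Proof. by rewrite /pairing !mul0mx mxE. Qed.

Lemma pairing0r al : pairing al 0 = 0.
Proof. by rewrite /pairing trmx0 mulmx0 mxE. Qed.

Lemma pairing_delta j k : pairing (delta_mx 0 j) (delta_mx 0 k) = om j k.
Proof. by rewrite /pairing -rowE trmx_delta -colE !mxE. Qed.

Lemma pairing_sum al be : pairing al be = \sum_p \sum_q om p q * (al 0 p * be 0 q).
Proof.
rewrite /pairing mxE exchange_big/=; apply: eq_bigr => q _.
rewrite !mxE mulr_suml; apply: eq_bigr => p _.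
by rewrite [_ * om _ _]mulrC mulrA.
Qed.

Lemma pairing_skew al be : om^T = - om -> pairing be al = - pairing al be.
Proof.
move=> omT; rewrite /pairing.
have -> : (be *m om *m al^T) 0 0 = (be *m om *m al^T)^T 0 0 by rewrite [RHS]mxE.
by rewrite !trmx_mul trmxK omT mulNmx mulmxN mulmxA !mxE.
Qed.

Lemma pairing_nondegenerate al : om \in unitmx ->
  (forall be, pairing al be = 0) -> al = 0.
Proof.
move=> omU al0; suff : al *m om = 0 by move=> /(canRL (mulmxK omU)); rewrite mul0mx.
apply/rowP => j; have := al0 (delta_mx 0 j).
by rewrite /pairing trmx_delta -colE !mxE.
Qed.

#[local] Opaque frame vert pairing.

(** This and the three endomorphisms below extend the tables linearly from the frame, using [vert]
    and [lsubmx] as coordinates. *)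
Definition std_metric : bilinear_field R (n + n) := fun x a c =>
  pairing (vert x a) (lsubmx c) + pairing (vert x c) (lsubmx a).
Definition std_I : endo_field R (n + n) := fun x a =>
  frame x ('i%C *: vert x a) (- 'i%C *: lsubmx a).
Definition std_J : endo_field R (n + n) := fun x a =>
  frame x (- lsubmx a) (vert x a).
Definition std_K : endo_field R (n + n) := fun x a =>
  frame x (- 'i%C *: lsubmx a) (- 'i%C *: vert x a).

Lemma std_I_frame x al be : std_I x (frame x al be) = frame x ('i%C *: al) (- 'i%C *: be).
Proof. by rewrite /std_I vert_frame lsubmx_frame. Qed.

Lemma std_J_frame x al be : std_J x (frame x al be) = frame x (- be) al.
Proof. by rewrite /std_J vert_frame lsubmx_frame. Qed.

Lemma std_K_frame x al be :
  std_K x (frame x al be) = frame x (- 'i%C *: be) (- 'i%C *: al).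
Proof. by rewrite /std_K vert_frame lsubmx_frame. Qed.

Lemma std_I_linear x : linear (std_I x).
Proof.
move=> k a c; rewrite /std_I vert_linear lsubmx_linear -frameP; congr frame;
  by rewrite scalerDr !scalerA mulrC.
Qed.

Lemma std_J_linear x : linear (std_J x).
Proof.
by move=> k a c; rewrite /std_J vert_linear lsubmx_linear -frameP opprD scalerN.
Qed.

Lemma std_K_linear x : linear (std_K x).
Proof.
move=> k a c; rewrite /std_K vert_linear lsubmx_linear -frameP; congr frame;
  by rewrite scalerDr !scalerA mulrC.
Qed.

Lemma std_metric_sym x a c : std_metric x a c = std_metric x c a.
Proof. by rewrite /std_metric addrC. Qed.

Lemma std_metric_scalar x a : scalar (std_metric x a).
Proof.
move=> k c e; rewrite /std_metric vert_linear lsubmx_linear.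
move: (vert x a) (vert x c) (vert x e) (lsubmx a) (lsubmx c) (lsubmx e).
by move=> p q r s t u; rewrite pairingDr pairingZr pairingDl pairingZl mulrDr addrACA.
Qed.

Lemma std_metric_bilinear U : bilinear_on U std_metric.
Proof.
move=> x _; split=> a; first exact: std_metric_scalar.
by move=> k c e; rewrite ![std_metric x _ a]std_metric_sym; exact: std_metric_scalar.
Qed.

Variables (v h : 'I_n -> vector_field R (n + n)).
Hypotheses (vE : forall j x, v j x = frame x (delta_mx 0 j) 0)
           (hE : forall j x, h j x = frame x 0 (delta_mx 0 j)).

Lemma frame_expansion x a :
  a = \sum_j vert x a 0 j *: v j x + \sum_j lsubmx a 0 j *: h j x.
Proof.
rewrite -[LHS](frame_vert x) {1}(row_sum_delta (vert x a)) [in LHS](row_sum_delta (lsubmx a)).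
rewrite -[X in frame x X]addr0 -[X in frame x _ X]add0r frameD; congr (_ + _).
  elim/big_rec2: _ => [|j y1 y2 _ <-]; first exact: frame0.
  by rewrite vE -frameP scaler0 addr0.
elim/big_rec2: _ => [|j y1 y2 _ <-]; first exact: frame0.
by rewrite hE -frameP scaler0 addr0.
Qed.

(** The uniqueness principle that lets tables on the frame determine tensors. *)
Lemma linear_frame_ext (Z : lmodType C) (E F : X -> Z) x : linear E -> linear F ->
  (forall j, E (v j x) = F (v j x)) -> (forall j, E (h j x) = F (h j x)) ->
  E =1 F.
Proof.
move=> lE lF Ev Eh a.
pose E' : {linear X -> Z} := HB.pack E (GRing.isLinear.Build _ _ _ _ E lE).
pose F' : {linear X -> Z} := HB.pack F (GRing.isLinear.Build _ _ _ _ F lF).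
rewrite -[E]/(E' : X -> Z) -[F]/(F' : X -> Z) (frame_expansion x a) !linearD !linear_sum.
by congr (_ + _); apply: eq_bigr => j _; rewrite !linearZ /= ?Ev ?Eh.
Qed.

(** The [2 n] fields span by [frame_expansion], and the dimension is [2 n]. *)
Lemma frame_basis x : basis_of fullv
  ([seq v j x | j <- enum 'I_n] ++ [seq h j x | j <- enum 'I_n]).
Proof.
have sz (f : 'I_n -> X) : size [seq f j | j <- enum 'I_n] = n.
  by rewrite size_map size_enum_ord.
rewrite basisEdim size_cat !sz dimvf /dim/= mul1n leqnn andbT.
apply/subvP => a _; rewrite (frame_expansion x a) rpredD// rpred_sum// => j _;
  rewrite rpredZ// memv_span// mem_cat; apply/orP; [left|right];
  by apply/mapP; exists j; rewrite ?mem_enum.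
Qed.

Lemma std_metric_frame x al1 be1 al2 be2 :
  std_metric x (frame x al1 be1) (frame x al2 be2) = pairing al1 be2 + pairing al2 be1.
Proof. by rewrite /std_metric !vert_frame !lsubmx_frame. Qed.

Lemma std_metric_framel x al be c :
  std_metric x (frame x al be) c = pairing al (lsubmx c) + pairing (vert x c) be.
Proof. by rewrite /std_metric vert_frame lsubmx_frame. Qed.

Lemma std_metric_framer x al be c :
  std_metric x c (frame x al be) = pairing (vert x c) be + pairing al (lsubmx c).
Proof. by rewrite /std_metric vert_frame lsubmx_frame. Qed.

Lemma std_metric_vv x j k : std_metric x (v j x) (v k x) = 0.
Proof. by rewrite !vE std_metric_frame !pairing0r addr0. Qed.

Lemma std_metric_vh x j k : std_metric x (v j x) (h k x) = om j k.
Proof. by rewrite vE hE std_metric_frame pairing0r addr0 pairing_delta. Qed.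

Lemma std_metric_hh x j k : std_metric x (h j x) (h k x) = 0.
Proof. by rewrite !hE std_metric_frame !pairing0l addr0. Qed.

Lemma std_metric_table U : metric_table U om v h std_metric.
Proof.
split=> [|x _ a c|x _ j k|x _ j k|x _ j k].
- exact: std_metric_bilinear.
- exact: std_metric_sym.
- exact: std_metric_vv.
- exact: std_metric_vh.
- exact: std_metric_hh.
Qed.

Lemma std_quaternion_table U : quaternion_table U v h std_I std_J std_K.
Proof.
split=> x _; try by [exact: std_I_linear|exact: std_J_linear|exact: std_K_linear];
  move=> j; rewrite ?vE ?hE /std_I /std_J /std_K vert_frame lsubmx_frame;
  by rewrite ?scaler0 ?oppr0 -?frameZ ?scaler0 -?frameN ?oppr0.
Qed.

(** The extension principle is applied in each slot in turn; the values on [(h, v)] come from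
    symmetry. *)
Lemma metric_table_std U g : metric_table U om v h g ->
  forall x, U x -> forall a c, g x a c = std_metric x a c.
Proof.
move=> [gb gs gvv gvh ghh] x Ux a c.
have sb := @std_metric_bilinear U x Ux.
have [gl gr] := gb x Ux.
have key j : g x (v j x) =1 std_metric x (v j x) /\ g x (h j x) =1 std_metric x (h j x).
  split; (apply: (@linear_frame_ext C _ _ x); [exact: gl|exact: sb.1|..]) => k.
  - by rewrite gvv// std_metric_vv.
  - by rewrite gvh// std_metric_vh.
  - by rewrite gs// gvh// std_metric_sym std_metric_vh.
  - by rewrite ghh// std_metric_hh.
apply: (@linear_frame_ext C (g x ^~ c) (std_metric x ^~ c) x); [exact: gr|exact: sb.2|..];
  by move=> k; have [k1 k2] := key k; rewrite ?k1 ?k2.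
Qed.

Lemma quaternion_table_std U I J K : quaternion_table U v h I J K ->
  forall x, U x -> [/\ I x =1 std_I x, J x =1 std_J x & K x =1 std_K x].
Proof.
move=> [lI lJ lK Iv Jv Kv Ih Jh Kh] x Ux.
have [_ _ _ Iv' Jv' Kv' Ih' Jh' Kh'] := std_quaternion_table U.
split; (apply: (@linear_frame_ext _ _ _ x);
  [by [exact: lI|exact: lJ|exact: lK]
  |by [exact: std_I_linear|exact: std_J_linear|exact: std_K_linear]|..]) => j.
- exact: etrans (Iv x Ux j) (esym (Iv' x Ux j)).
- exact: etrans (Ih x Ux j) (esym (Ih' x Ux j)).
- exact: etrans (Jv x Ux j) (esym (Jv' x Ux j)).
- exact: etrans (Jh x Ux j) (esym (Jh' x Ux j)).
- exact: etrans (Kv x Ux j) (esym (Kv' x Ux j)).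
- exact: etrans (Kh x Ux j) (esym (Kh' x Ux j)).
Qed.

(** * Quaternion relations, compatibility with the metric, and the form on the base *)

Section Hyperkahler_algebra.
Hypotheses (om_skew : om^T = - om) (om_unit : om \in unitmx).

(** Replaces the imaginary unit by a variable about which only [k * k = -1] is known, so that it
    behaves as an atom under rewriting. *)
Let imaginary_unit : exists2 k : C, k = 'i%C & k * k = -1.
Proof. by exists 'i%C; rewrite // -expr2 sqr_i. Qed.

Lemma std_II x a : std_I x (std_I x a) = - a.
Proof.
rewrite /std_I; have [k <- kk] := imaginary_unit.
by rewrite vert_frame lsubmx_frame !scalerA mulrNN kk !scaleN1r frameN frame_vert.
Qed.

Lemma std_JJ x a : std_J x (std_J x a) = - a.
Proof. by rewrite /std_J vert_frame lsubmx_frame frameN frame_vert. Qed.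

Lemma std_KK x a : std_K x (std_K x a) = - a.
Proof.
rewrite /std_K; have [k <- kk] := imaginary_unit.
by rewrite vert_frame lsubmx_frame !scalerA mulrNN kk !scaleN1r frameN frame_vert.
Qed.

Lemma std_IJK x a : std_I x (std_J x (std_K x a)) = - a.
Proof.
rewrite {1}/std_K std_J_frame std_I_frame; have [k <- kk] := imaginary_unit.
rewrite -[in RHS](frame_vert x a) -frameN; congr frame.
  by rewrite scaleNr opprK scalerA kk scaleN1r.
by rewrite scalerA mulrNN kk scaleN1r.
Qed.

Lemma std_metric_I x a c : std_metric x (std_I x a) (std_I x c) = std_metric x a c.
Proof.
rewrite std_metric_frame /std_metric; have [k <- kk] := imaginary_unit.
move: (vert x a) (vert x c) (lsubmx a) (lsubmx c) => p q r s.
by rewrite !pairingZl !pairingZr !mulrA mulrN kk opprK !mul1r.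
Qed.

(** [J] exchanges the two coordinates with one sign, and skewness of [om] absorbs that sign. *)
Lemma std_metric_J x a c : std_metric x (std_J x a) (std_J x c) = std_metric x a c.
Proof.
rewrite std_metric_frame /std_metric.
move: (vert x a) (vert x c) (lsubmx a) (lsubmx c) => p q r s.
by rewrite !pairingNl -(pairing_skew r q om_skew) -(pairing_skew s p om_skew) addrC.
Qed.

Lemma std_metric_K x a c : std_metric x (std_K x a) (std_K x c) = std_metric x a c.
Proof.
rewrite std_metric_frame /std_metric; have [k <- kk] := imaginary_unit.
move: (vert x a) (vert x c) (lsubmx a) (lsubmx c) => p q r s.
rewrite !pairingZl !pairingZr !mulrA mulrNN kk !mulN1r.
by rewrite -(pairing_skew r q om_skew) -(pairing_skew s p om_skew) addrC.
Qed.

(** Pairing with horizontal vectors detects the vertical coordinate, and conversely. *)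
Lemma std_metric_nondegenerate x a : (forall c, std_metric x a c = 0) -> a = 0.
Proof.
move=> a0; rewrite -(frame_vert x a) -(frame0 x); congr frame.
  apply: (pairing_nondegenerate om_unit) => be; have := a0 (frame x 0 be).
  by rewrite /std_metric vert_frame lsubmx_frame pairing0l addr0.
apply: (pairing_nondegenerate om_unit) => al; have := a0 (frame x al 0).
rewrite /std_metric vert_frame lsubmx_frame pairing0r add0r pairing_skew//.
by move=> /eqP; rewrite oppr_eq0 => /eqP.
Qed.

(** The terms in the vertical coordinates cancel between [J] and [K], while the horizontal ones add
    up, whence the 2. *)
Lemma std_Omega_minus x a c :
  Omega_minus std_metric std_J std_K x a c = 2 * pairing (lsubmx a) (lsubmx c).
Proof.
rewrite /Omega_minus /Omega_of /std_J /std_K -[a](frame_vert x).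
rewrite !std_metric_frame lsubmx_frame; have [k <- kk] := imaginary_unit.
move: (vert x a) (vert x c) (lsubmx a) (lsubmx c) => p q r s.
rewrite pairingZl pairingZr pairingNl (pairing_skew r s om_skew).
move: (pairing p q) (pairing r s) => y z.
have -> : k * (- k * y + - k * - z) = - (k * k) * (y - z) by ring.
by rewrite kk; ring.
Qed.

End Hyperkahler_algebra.

(** The 2 arises because the double sum meets each unordered pair of indices twice; it matches the
    one in [std_Omega_minus]. *)
Lemma base_formE (x a c : rV) : om^T = - om -> base_form om x a c = 2 * pairing a c.
Proof.
move=> omT.
rewrite (_ : 2 * _ = pairing a c - pairing c a); last first.
  by rewrite (pairing_skew a c omT); ring.
rewrite !pairing_sum -sumrB; apply: eq_bigr => p _; rewrite -sumrB; apply: eq_bigr => q _.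
by rewrite /wedge_dz; ring.
Qed.

End Frame.

(** * The Levi-Civita connection *)

Section Connection.
Context (R : realType) (n : nat).
Local Notation C := R[i].
Local Notation X := 'rV[C]_(n + n).
Local Notation rV := 'rV[C]_n.
Variables (N : X -> 'M[C]_n) (om : 'M[C]_n) (U : set X).
Hypotheses (U_open : open U) (N_hol : holomorphic_on U N).
Implicit Types (x a c : X) (u w : vector_field R (n + n)).

Lemma differentiable_row_mx (A B : X -> rV) x :
  differentiable A x -> differentiable B x ->
  differentiable (fun y => row_mx (A y) (B y)) x.
Proof.
move=> /differentiable_mxP dA /differentiable_mxP dB; apply/differentiable_mxP => i j.
by under eq_fun do rewrite mxE; case: (fintype.split j) => k.
Qed.

Lemma derive_row_mx (A B : X -> rV) x a :
  differentiable A x -> differentiable B x ->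
  'D_a (fun y => row_mx (A y) (B y)) x = row_mx ('D_a A x) ('D_a B x).
Proof.
move=> dA dB; apply/matrixP => i j.
rewrite derive_entry; last exact: differentiable_row_mx.
under eq_fun do rewrite mxE.
by rewrite mxE; case: (fintype.split j) => k; rewrite derive_entry.
Qed.

Lemma vertE x a : vert N x a = rsubmx a - lsubmx a *m N x.
Proof. by []. Qed.

Lemma frameE x (al be : rV) : frame N x al be = row_mx be (al + be *m N x).
Proof. by []. Qed.

#[local] Opaque frame vert.

Lemma differentiable_lsub u x : differentiable u x ->
  differentiable (fun y => lsubmx (u y)) x.
Proof.
move=> /differentiable_mxP du; apply/differentiable_mxP => i j.
by under eq_fun do rewrite mxE; exact: du.
Qed.

Lemma differentiable_rsub u x : differentiable u x ->
  differentiable (fun y => rsubmx (u y)) x.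
Proof.
move=> /differentiable_mxP du; apply/differentiable_mxP => i j.
by under eq_fun do rewrite mxE; exact: du.
Qed.

Lemma differentiable_vert u x : U x -> differentiable u x ->
  differentiable (fun y => vert N y (u y)) x.
Proof.
move=> Ux du; under eq_fun do rewrite vertE.
apply: differentiableB; first exact: differentiable_rsub.
by apply: differentiable_mulmx; [exact: differentiable_lsub|exact: N_hol].
Qed.

Lemma differentiable_frame (al be : X -> rV) x : U x ->
  differentiable al x -> differentiable be x ->
  differentiable (fun y => frame N y (al y) (be y)) x.
Proof.
move=> Ux dal dbe; under eq_fun do rewrite frameE.
have dm := differentiable_mulmx dbe (N_hol Ux).
exact: differentiable_row_mx dbe (differentiableD dal dm).
Qed.

Lemma derive_frame (al be : X -> rV) x a : U x ->
  differentiable al x -> differentiable be x ->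
  'D_a (fun y => frame N y (al y) (be y)) x =
  frame N x ('D_a al x) ('D_a be x) + row_mx 0 (be x *m 'D_a N x).
Proof.
move=> Ux dal dbe; under eq_fun do rewrite frameE.
have dbN := differentiable_mulmx dbe (N_hol Ux).
have -> := derive_row_mx a dbe (differentiableD dal dbN).
have -> := deriveD (diff_derivable (v := a) dal) (diff_derivable (v := a) dbN).
have -> := derive_mulmx a dbe (N_hol Ux).
have -> := frameE x ('D_a al x) ('D_a be x).
move: ('D_a al x) ('D_a be x) ('D_a N x) (N x) (be x) => p q r s t.
by rewrite add_row_mx addr0 addrA.
Qed.

Definition vderiv x (be : rV) : 'M[C]_n := 'D_(row_mx 0 be) N x.

(** The formula is forced. Parallelism of [I] preserves its eigenspaces, spanned by the [v_j] and by
    the [h_j]. Since [[h_i, v_j]] is vertical, being torsion-free gives [D_(v_j) h_i = 0] and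
    [D_(h_i) v_j = [h_i, v_j]], which is minus the derivative of row [i] of [N] along [v_j].
    Parallelism of [J] copies the same coefficients to the [h_j]. *)
Definition connection u w : vector_field R (n + n) := fun x =>
  frame N x
    ('D_(u x) (fun y => vert N y (w y)) x - vert N x (w x) *m vderiv x (lsubmx (u x)))
    ('D_(u x) (fun y => lsubmx (w y)) x - lsubmx (w x) *m vderiv x (lsubmx (u x))).

Lemma vderivD x b1 b2 : U x -> vderiv x (b1 + b2) = vderiv x b1 + vderiv x b2.
Proof.
move=> Ux; rewrite /vderiv -derive_dirD; last exact: N_hol.
by rewrite add_row_mx addr0.
Qed.

Lemma vderivZ x k b : U x -> vderiv x (k *: b) = k *: vderiv x b.
Proof.
move=> Ux; rewrite /vderiv -derive_dirZ; last exact: N_hol.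
by rewrite scale_row_mx scaler0.
Qed.

Lemma lsubmxD (a c : X) : lsubmx (a + c) = lsubmx a + lsubmx c :> rV.
Proof. by rewrite linearD. Qed.

Lemma lsubmxZ k (a : X) : lsubmx (k *: a) = k *: lsubmx a :> rV.
Proof. by rewrite linearZ. Qed.

#[local] Opaque vderiv.

Lemma holomorphic_lsub u : holomorphic_on U u -> holomorphic_on U (fun y => lsubmx (u y) : rV).
Proof. by move=> hu x Ux; exact: differentiable_lsub (hu x Ux). Qed.

Lemma holomorphic_vert u : holomorphic_on U u -> holomorphic_on U (fun y => vert N y (u y)).
Proof. by move=> hu x Ux; exact: differentiable_vert Ux (hu x Ux). Qed.

Lemma holomorphic_vderiv (b : X -> rV) : holomorphic_on U b ->
  holomorphic_on U (fun y => vderiv y (b y)).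
Proof.
move=> hb; have h0 : holomorphic_on U (fun y => row_mx 0 (b y) : X).
  move=> y Uy; exact: differentiable_row_mx (differentiable_cst _ _) (hb y Uy).
exact: holomorphic_derive_along U_open N_hol h0.
Qed.

Lemma connection_hol u w : holomorphic_on U u -> holomorphic_on U w ->
  holomorphic_on U (connection u w).
Proof.
move=> hu hw x Ux.
have hl := holomorphic_lsub hu; have hv := holomorphic_vert hw.
have hb := holomorphic_lsub hw; have hP := holomorphic_vderiv hl.
have d1 := holomorphic_derive_along U_open hv hu Ux.
have d2 := holomorphic_derive_along U_open hb hu Ux.
have d3 := differentiable_mulmx (hv x Ux) (hP x Ux).
have d4 := differentiable_mulmx (hb x Ux) (hP x Ux).
exact: differentiable_frame Ux (differentiableB d1 d3) (differentiableB d2 d4).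
Qed.

Lemma connection_dirD u1 u2 w x : holomorphic_on U w -> U x ->
  connection (fun y => u1 y + u2 y) w x = connection u1 w x + connection u2 w x.
Proof.
move=> hw Ux; rewrite /connection.
have -> := derive_dirD (u1 x) (u2 x) (holomorphic_vert hw Ux).
have -> := derive_dirD (u1 x) (u2 x) (holomorphic_lsub hw Ux).
have -> := lsubmxD (u1 x) (u2 x); have -> := vderivD (lsubmx (u1 x)) (lsubmx (u2 x)) Ux.
move: ('D_(u1 x) _ x) ('D_(u2 x) _ x) => p1 p2.
move: ('D_(u1 x) _ x) ('D_(u2 x) _ x) => q1 q2.
rewrite -frameD !mulmxDr !opprD.
by congr (frame N x _ _); rewrite addrACA.
Qed.

Lemma connection_dirZ (f : X -> C) u w x : holomorphic_on U w -> U x ->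
  connection (fun y => f y *: u y) w x = f x *: connection u w x.
Proof.
move=> hw Ux; rewrite /connection.
have -> := derive_dirZ (f x) (u x) (holomorphic_vert hw Ux).
have -> := derive_dirZ (f x) (u x) (holomorphic_lsub hw Ux).
have -> := lsubmxZ (f x) (u x); have -> := vderivZ (f x) (lsubmx (u x)) Ux.
move: ('D_(u x) _ x) ('D_(u x) _ x) => p q.
rewrite -frameZ -!scalemxAr.
by congr (frame N x _ _); rewrite scalerBr.
Qed.

Lemma connection_addf u w1 w2 x : holomorphic_on U w1 -> holomorphic_on U w2 -> U x ->
  connection u (fun y => w1 y + w2 y) x = connection u w1 x + connection u w2 x.
Proof.
move=> h1 h2 Ux; rewrite /connection.
have v1 := holomorphic_vert h1 Ux; have v2 := holomorphic_vert h2 Ux.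
have l1 := holomorphic_lsub h1 Ux; have l2 := holomorphic_lsub h2 Ux.
have -> : 'D_(u x) (fun y => vert N y (w1 y + w2 y)) x =
    'D_(u x) (fun y => vert N y (w1 y)) x + 'D_(u x) (fun y => vert N y (w2 y)) x.
  have <- := deriveD (diff_derivable (v := u x) v1) (diff_derivable (v := u x) v2).
  by congr (derive _ x (u x)); apply/funext => y; exact: vertD.
have -> : 'D_(u x) (fun y => lsubmx (w1 y + w2 y) : rV) x =
    'D_(u x) (fun y => lsubmx (w1 y)) x + 'D_(u x) (fun y => lsubmx (w2 y)) x.
  have <- := deriveD (diff_derivable (v := u x) l1) (diff_derivable (v := u x) l2).
  by congr (derive _ x (u x)); apply/funext => y; exact: lsubmxD.
have -> := vertD N x (w1 x) (w2 x); have -> := lsubmxD (w1 x) (w2 x).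
move: ('D_(u x) (fun y => vert N y (w1 y)) x) => p1.
move: ('D_(u x) (fun y => vert N y (w2 y)) x) => p2.
move: ('D_(u x) (fun y => lsubmx (w1 y)) x) => q1.
move: ('D_(u x) (fun y => lsubmx (w2 y)) x) => q2.
move: (vert N x (w1 x)) (vert N x (w2 x)) (lsubmx (w1 x)) (lsubmx (w2 x)) => r1 r2 s1 s2.
rewrite -frameD !mulmxDl !opprD.
by congr (frame N x _ _); rewrite addrACA.
Qed.

Lemma connection_leibnizf (f : X -> C) u w x :
  holomorphic_on U f -> holomorphic_on U w -> U x ->
  connection u (fun y => f y *: w y) x =
  'D_(u x) f x *: w x + f x *: connection u w x.
Proof.
move=> hf hw Ux; rewrite /connection.
have hv := holomorphic_vert hw Ux; have hl := holomorphic_lsub hw Ux.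
have -> : 'D_(u x) (fun y => vert N y (f y *: w y)) x =
    'D_(u x) f x *: vert N x (w x) + f x *: 'D_(u x) (fun y => vert N y (w y)) x.
  have <- := derive_scale_mx (u x) (hf x Ux) hv.
  by congr (derive _ x (u x)); apply/funext => y; exact: vertZ.
have -> : 'D_(u x) (fun y => lsubmx (f y *: w y) : rV) x =
    'D_(u x) f x *: lsubmx (w x) + f x *: 'D_(u x) (fun y => lsubmx (w y)) x.
  have <- := derive_scale_mx (u x) (hf x Ux) hl.
  by congr (derive _ x (u x)); apply/funext => y; exact: lsubmxZ.
have -> := vertZ N x (f x) (w x); have -> := lsubmxZ (f x) (w x).
have -> : 'D_(u x) f x *: w x =
    'D_(u x) f x *: frame N x (vert N x (w x)) (lsubmx (w x)) by rewrite frame_vert.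
move: ('D_(u x) (fun y => vert N y (w y)) x) => p.
move: ('D_(u x) (fun y => lsubmx (w y)) x) ('D_(u x) f x) => q k.
move: (vert N x (w x)) (lsubmx (w x)) => r s.
rewrite -!frameZ -frameD -!scalemxAl.
by congr (frame N x _ _); rewrite scalerBr addrA.
Qed.

Lemma connection_is_holomorphic : holomorphic_connection U connection.
Proof.
split.
- exact: connection_hol.
- by move=> u1 u2 w _ _ hw x Ux; exact: connection_dirD.
- by move=> f u w _ _ hw x Ux; exact: connection_dirZ.
- by move=> u w1 w2 _ h1 h2 x Ux; exact: connection_addf.
- by move=> f u w hf _ hw x Ux; exact: connection_leibnizf.
Qed.

(** The three facts about [N]: symmetry of its vertical derivatives; vanishing of the brackets
    [[h_i, h_j]]; and membership of the connection matrix in the Lie algebra preserving [om]. *)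
Hypothesis vderiv_sym : forall x, U x -> forall b c : rV,
  b *m vderiv x c = c *m vderiv x b.
Hypothesis horizontal_flat : forall x, U x -> forall b c : rV,
  b *m 'D_(frame N x 0 c) N x = c *m 'D_(frame N x 0 b) N x.
Hypothesis vderiv_skew : forall x, U x -> forall b : rV,
  vderiv x b *m om + om *m (vderiv x b)^T = 0.

(** Besides the derivatives of the coefficients, the [h_j] themselves vary, contributing a vertical
    term through [N]. *)
Lemma derive_vector_field u a x : U x -> differentiable u x ->
  'D_a u x = frame N x ('D_a (fun y => vert N y (u y)) x)
                       ('D_a (fun y => lsubmx (u y)) x)
             + row_mx 0 (lsubmx (u x) *m 'D_a N x).
Proof.
move=> Ux du; have <- := derive_frame a Ux (differentiable_vert Ux du) (differentiable_lsub du).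
by congr (derive _ x a); apply/funext => y; exact: esym (frame_vert N y (u y)).
Qed.

Lemma derive_N_split x a : U x ->
  'D_a N x = 'D_(frame N x 0 (lsubmx a)) N x + vderiv x (vert N x a).
Proof.
move=> Ux; have -> : vderiv x (vert N x a) = 'D_(row_mx 0 (vert N x a)) N x by [].
have <- := derive_dirD (frame N x 0 (lsubmx a)) (row_mx 0 (vert N x a)) (N_hol Ux).
congr (derive _ _ _); rewrite -[LHS](frame_vert N x) !frameE add_row_mx addr0 add0r.
by rewrite [vert N x a + _]addrC.
Qed.

Lemma connection_torsion_free u w x : holomorphic_on U u -> holomorphic_on U w ->
  U x -> connection u w x - connection w u x = lie_bracket u w x.
Proof.
move=> hu hw Ux; rewrite /lie_bracket.
have -> := derive_vector_field (u x) Ux (hw x Ux).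
have -> := derive_vector_field (w x) Ux (hu x Ux).
rewrite /connection.
have -> := derive_N_split (u x) Ux; have -> := derive_N_split (w x) Ux.
(* The first instance cancels the connection terms along the [h_j], the next two match the vertical
   connection terms with those of the bracket, and flatness removes the purely horizontal part. *)
move: (vderiv_sym Ux (lsubmx (u x)) (lsubmx (w x))).
move: (vderiv_sym Ux (vert N x (u x)) (lsubmx (w x))).
move: (vderiv_sym Ux (vert N x (w x)) (lsubmx (u x))).
move: (horizontal_flat Ux (lsubmx (w x)) (lsubmx (u x))).
rewrite !mulmxDr.
move: ('D_(u x) (fun y => vert N y (w y)) x) => a1.
move: ('D_(u x) (fun y => lsubmx (w y)) x) => b1.
move: ('D_(w x) (fun y => vert N y (u y)) x) => a2.
move: ('D_(w x) (fun y => lsubmx (u y)) x) => b2.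
move: ('D_(frame N x 0 (lsubmx (u x))) N x) => F2.
move: ('D_(frame N x 0 (lsubmx (w x))) N x) => F1.
move: (vderiv x (lsubmx (u x))) (vderiv x (lsubmx (w x))) => P4 P2.
move: (vderiv x (vert N x (u x))) (vderiv x (vert N x (w x))) => P1 P3.
move: (vert N x (u x)) (vert N x (w x)) (lsubmx (u x)) (lsubmx (w x)) => p q r s.
move=> -> -> -> ->; rewrite !frameE !mulmxBl.
move: (r *m F1) (r *m P3) (s *m P1) (s *m P4) => F P P' Q.
move: (b1 *m N x) (b2 *m N x) (Q *m N x) => c1 c2 c3.
rewrite !opp_row_mx !add_row_mx opp_row_mx add_row_mx.
by congr row_mx; apply/rowP => j; rewrite !mxE; ring.
Qed.

Lemma pairing_diffE (A B : X -> rV) x a : differentiable A x -> differentiable B x ->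
  differentiable (fun y => pairing om (A y) (B y)) x /\
  'D_a (fun y => pairing om (A y) (B y)) x =
  pairing om ('D_a A x) (B x) + pairing om (A x) ('D_a B x).
Proof.
move=> dA dB.
have dA' := (differentiable_mxP A x).1 dA; have dB' := (differentiable_mxP B x).1 dB.
under eq_fun do rewrite pairing_sum.
have d1 p q : differentiable (fun y => A y 0 p * B y 0 q) x.
  exact: differentiableM (dA' 0 p) (dB' 0 q).
have d2 p q : differentiable (fun y => om p q * (A y 0 p * B y 0 q)) x.
  exact: differentiableM (differentiable_cst _ _) (d1 p q).
split; first by apply: differentiable_sumT => p; exact: differentiable_sumT.
rewrite !pairing_sum -big_split/=.
have -> := derive_sumT a (fun p => differentiable_sumT (d2 p)).
apply: eq_bigr => p _; have -> := derive_sumT a (d2 p).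
rewrite -big_split/=; apply: eq_bigr => q _.
have -> : 'D_a (fun y => om p q * (A y 0 p * B y 0 q)) x =
    om p q * 'D_a (fun y => A y 0 p * B y 0 q) x.
  exact: (deriveZ (om p q) (diff_derivable (v := a) (d1 p q))).
have E := deriveM (diff_derivable (v := a) (dA' 0 p)) (diff_derivable (v := a) (dB' 0 q)).
apply: (etrans (congr1 (fun z => om p q * z) E)).
rewrite -mulrDr [in RHS]addrC; congr (om p q * (_ + _)).
  exact: (congr1 (fun z => A x 0 p * z) (esym (derive_entry a 0 q dB))).
exact: (etrans (mulrC _ _) (congr1 (fun z => z * B x 0 q) (esym (derive_entry a 0 p dA)))).
Qed.

(** Infinitesimal invariance of the pairing; it cancels the connection terms in
    [connection_metric]. *)
Lemma pairing_vderiv x (b p q : rV) : U x ->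
  pairing om (p *m vderiv x b) q = - pairing om p (q *m vderiv x b).
Proof.
move=> Ux; apply/eqP; rewrite -addr_eq0; apply/eqP.
have := vderiv_skew Ux b; move: (vderiv x b) => P PE.
have E : pairing om (p *m P) q + pairing om p (q *m P) =
    (p *m (P *m om + om *m P^T) *m q^T) 0 0.
  by rewrite /pairing trmx_mul mulmxDr mulmxDl !mulmxA [RHS]mxE.
by rewrite E PE mulmx0 mul0mx mxE.
Qed.

Lemma std_metric_diffE w1 w2 x a : U x -> differentiable w1 x -> differentiable w2 x ->
  differentiable (fun y => std_metric N om y (w1 y) (w2 y)) x /\
  'D_a (fun y => std_metric N om y (w1 y) (w2 y)) x =
  (pairing om ('D_a (fun y => vert N y (w1 y)) x) (lsubmx (w2 x))
   + pairing om (vert N x (w1 x)) ('D_a (fun y => lsubmx (w2 y)) x))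
  + (pairing om ('D_a (fun y => vert N y (w2 y)) x) (lsubmx (w1 x))
   + pairing om (vert N x (w2 x)) ('D_a (fun y => lsubmx (w1 y)) x)).
Proof.
move=> Ux h1 h2.
have [d1 E1] := pairing_diffE a (differentiable_vert Ux h1) (differentiable_lsub h2).
have [d2 E2] := pairing_diffE a (differentiable_vert Ux h2) (differentiable_lsub h1).
split; first exact: differentiableD d1 d2.
have := deriveD (diff_derivable (v := a) d1) (diff_derivable (v := a) d2).
by rewrite E1 E2.
Qed.

Lemma connection_metric u w1 w2 x : holomorphic_on U w1 -> holomorphic_on U w2 -> U x ->
  'D_(u x) (fun y => std_metric N om y (w1 y) (w2 y)) x =
  std_metric N om x (connection u w1 x) (w2 x)
  + std_metric N om x (w1 x) (connection u w2 x).
Proof.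
move=> h1 h2 Ux.
have [_ ->] := std_metric_diffE (u x) Ux (h1 x Ux) (h2 x Ux).
rewrite /connection std_metric_framel std_metric_framer.
have K1 := pairing_vderiv (lsubmx (u x)) (vert N x (w1 x)) (lsubmx (w2 x)) Ux.
have K2 := pairing_vderiv (lsubmx (u x)) (vert N x (w2 x)) (lsubmx (w1 x)) Ux.
move: K1 K2.
move: ('D_(u x) (fun y => vert N y (w1 y)) x) => a1.
move: ('D_(u x) (fun y => lsubmx (w1 y)) x) => b1.
move: ('D_(u x) (fun y => vert N y (w2 y)) x) => a2.
move: ('D_(u x) (fun y => lsubmx (w2 y)) x) => b2.
move: (vderiv x (lsubmx (u x))) => P.
move: (vert N x (w1 x)) (vert N x (w2 x)) (lsubmx (w1 x)) (lsubmx (w2 x)) => p1 p2 s1 s2.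
move=> K1 K2.
rewrite (pairingDl om a1) (pairingDl om a2) !pairingNl K1 K2.
rewrite (pairingDr om p2 b1) (pairingDr om p1 b2) !pairingNr.
by ring.
Qed.

(** The same matrix acts on both coordinates, so an endomorphism with constant coefficients in them
    commutes with the connection. *)
Lemma connection_frame u (al be : X -> rV) x :
  connection u (fun y => frame N y (al y) (be y)) x =
  frame N x ('D_(u x) al x - al x *m vderiv x (lsubmx (u x)))
            ('D_(u x) be x - be x *m vderiv x (lsubmx (u x))).
Proof.
rewrite /connection vert_frame lsubmx_frame.
have -> : 'D_(u x) (fun y => vert N y (frame N y (al y) (be y))) x = 'D_(u x) al x.
  by congr (derive _ x (u x)); apply/funext => y; exact: vert_frame.
have -> // : 'D_(u x) (fun y => lsubmx (frame N y (al y) (be y))) x = 'D_(u x) be x.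
by congr (derive _ x (u x)); apply/funext => y; exact: lsubmx_frame.
Qed.

Lemma deriveZ_mx (k : C) (A : X -> rV) x a : differentiable A x ->
  'D_a (fun y => k *: A y) x = k *: 'D_a A x.
Proof. by move=> dA; exact: (deriveZ k (diff_derivable (v := a) dA)). Qed.

Lemma deriveN_mx (A : X -> rV) x a : differentiable A x ->
  'D_a (fun y => - A y) x = - 'D_a A x.
Proof. by move=> dA; exact: (deriveN (diff_derivable (v := a) dA)). Qed.

Lemma connection_std_I u w x : holomorphic_on U w -> U x ->
  connection u (fun y => std_I N y (w y)) x = std_I N x (connection u w x).
Proof.
move=> hw Ux; have hv := holomorphic_vert hw Ux; have hl := holomorphic_lsub hw Ux.
have -> := connection_frame u (fun y => 'i%C *: vert N y (w y))
  (fun y => - 'i%C *: lsubmx (w y)) x.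
have -> := deriveZ_mx 'i%C (u x) hv; have -> := deriveZ_mx (- 'i%C) (u x) hl.
have -> := std_I_frame N x ('D_(u x) (fun y => vert N y (w y)) x - vert N x (w x) *m vderiv x (lsubmx (u x)))
    ('D_(u x) (fun y => lsubmx (w y)) x - lsubmx (w x) *m vderiv x (lsubmx (u x))).
move: ('D_(u x) (fun y => vert N y (w y)) x) => a1.
move: ('D_(u x) (fun y => lsubmx (w y)) x) => b1.
move: (vderiv x (lsubmx (u x))) (vert N x (w x)) (lsubmx (w x)) 'i%C (- 'i%C) => P p s k k'.
by rewrite -!scalemxAl -!scalerBr.
Qed.

Lemma connection_std_J u w x : holomorphic_on U w -> U x ->
  connection u (fun y => std_J N y (w y)) x = std_J N x (connection u w x).
Proof.
move=> hw Ux; have hv := holomorphic_vert hw Ux; have hl := holomorphic_lsub hw Ux.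
have -> := connection_frame u (fun y => - lsubmx (w y)) (fun y => vert N y (w y)) x.
have -> := deriveN_mx (u x) hl.
have -> := std_J_frame N x ('D_(u x) (fun y => vert N y (w y)) x - vert N x (w x) *m vderiv x (lsubmx (u x)))
    ('D_(u x) (fun y => lsubmx (w y)) x - lsubmx (w x) *m vderiv x (lsubmx (u x))).
move: ('D_(u x) (fun y => vert N y (w y)) x) => a1.
move: ('D_(u x) (fun y => lsubmx (w y)) x) => b1.
move: (vderiv x (lsubmx (u x))) (vert N x (w x)) (lsubmx (w x)) => P p s.
by rewrite mulNmx opprB opprK [- b1 + _]addrC.
Qed.

Lemma connection_std_K u w x : holomorphic_on U w -> U x ->
  connection u (fun y => std_K N y (w y)) x = std_K N x (connection u w x).
Proof.
move=> hw Ux; have hv := holomorphic_vert hw Ux; have hl := holomorphic_lsub hw Ux.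
have -> := connection_frame u (fun y => - 'i%C *: lsubmx (w y))
  (fun y => - 'i%C *: vert N y (w y)) x.
have -> := deriveZ_mx (- 'i%C) (u x) hv; have -> := deriveZ_mx (- 'i%C) (u x) hl.
have -> := std_K_frame N x ('D_(u x) (fun y => vert N y (w y)) x - vert N x (w x) *m vderiv x (lsubmx (u x)))
    ('D_(u x) (fun y => lsubmx (w y)) x - lsubmx (w x) *m vderiv x (lsubmx (u x))).
move: ('D_(u x) (fun y => vert N y (w y)) x) => a1.
move: ('D_(u x) (fun y => lsubmx (w y)) x) => b1.
move: (vderiv x (lsubmx (u x))) (vert N x (w x)) (lsubmx (w x)) (- 'i%C) => P p s k.
by rewrite -!scalemxAl -!scalerBr.
Qed.

End Connection.

(** * The Plebanski equation *)

Section Plebanski.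
Context (R : realType) (n : nat).
Local Notation C := R[i].
Local Notation X := 'rV[C]_(n + n).
Local Notation rV := 'rV[C]_n.
Variables (om : 'M[C]_n) (U : set X) (W : X -> C).
Hypotheses (om_skew : om^T = - om) (om_unit : om \in unitmx).
Hypotheses (U_open : open U) (W_hol : holomorphic_on U W).

Local Notation dz j := (d_z R (n := n) j).
Local Notation dth j := (d_theta R (n := n) j).
Local Notation eta := (invmx om).

Definition hess (j p : 'I_n) : X -> C := 'D_(dth j) ('D_(dth p) W).
Definition hess_mx x : 'M[C]_n := \matrix_(j, p) hess j p x.
(** Row [j] holds the vertical components of [h_j]; see [h_fieldE]. *)
Definition hor_mx x : 'M[C]_n := hess_mx x *m eta.
Definition third (i j p : 'I_n) : X -> C := 'D_(dth i) (hess j p).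

Lemma eta_skew : eta^T = - eta.
Proof.
have E : eta^T *m om = - 1%:M.
  by rewrite -[om in _ *m om]opprK -om_skew mulmxN -trmx_mul mulmxV// trmx1.
by rewrite -[LHS](mulmxK om_unit) E mulNmx mul1mx.
Qed.

Lemma eta_skew_entry p q : eta p q = - eta q p.
Proof. by have /matrixP/(_ q p) := eta_skew; rewrite !mxE. Qed.

Lemma hess_hol j p : holomorphic_on U (hess j p).
Proof. exact/(holomorphic_derive _ U_open)/(holomorphic_derive _ U_open). Qed.

Lemma hess_sym j p x : U x -> hess j p x = hess p j x.
Proof. exact: (derive_comm _ _ U_open W_hol). Qed.

Lemma third_sym23 i j p x : U x -> third i j p x = third i p j x.
Proof. by move=> Ux; apply: (derive_eq_open _ U_open _ Ux) => y; exact: hess_sym. Qed.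

Lemma third_sym12 i j p x : U x -> third i j p x = third j i p x.
Proof. exact: (derive_comm _ _ U_open (holomorphic_derive _ U_open W_hol)). Qed.

Lemma hess_mx_diff x : U x -> differentiable hess_mx x.
Proof.
move=> Ux; apply/differentiable_mxP => i j.
by under eq_fun do rewrite mxE; exact: hess_hol.
Qed.

Lemma hor_mx_hol : holomorphic_on U hor_mx.
Proof. by move=> x Ux; exact: (differentiable_mulmx (hess_mx_diff Ux) (differentiable_cst _ _)). Qed.

Lemma derive_hor_mx x a : U x -> 'D_a hor_mx x = 'D_a hess_mx x *m eta.
Proof.
move=> Ux; have -> := derive_mulmx a (hess_mx_diff Ux) (differentiable_cst eta x).
by rewrite derive_cst mulmx0 addr0.
Qed.

Lemma derive_hess_mx x a j p : U x -> 'D_a hess_mx x j p = 'D_a (hess j p) x.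
Proof.
move=> Ux; have -> := derive_entry a j p (hess_mx_diff Ux).
by congr (derive _ x a); apply/funext => y; rewrite mxE.
Qed.

Lemma vertical_sum (c : rV) : row_mx 0 c = \sum_i c 0 i *: dth i :> X.
Proof.
rewrite {1}(row_sum_delta c); elim/big_rec2: _ => [|i y z _ <-]; first by rewrite row_mx0.
by rewrite /d_theta delta_mx_rshift scale_row_mx add_row_mx scaler0 add0r.
Qed.

Lemma derive_sum_dir (f : X -> C) x (c : rV) (e : 'I_n -> X) : differentiable f x ->
  'D_(\sum_i c 0 i *: e i) f x = \sum_i c 0 i * 'D_(e i) f x.
Proof.
move=> df; rewrite deriveE// linear_sum; apply: eq_bigr => i _.
by have -> := deriveE (e i) df; rewrite linearZ.
Qed.

Lemma derive_hess_vertical x (c : rV) j p : U x ->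
  'D_(row_mx 0 c) hess_mx x j p = \sum_i c 0 i * third i j p x.
Proof.
by move=> Ux; rewrite derive_hess_mx// vertical_sum derive_sum_dir//; exact: hess_hol.
Qed.

(** Both sides contract [b], [c] and [eta] with the third vertical derivatives of [W], which are
    symmetric in their first two indices. *)
Lemma hor_vderiv_sym x : U x -> forall b c : rV,
  b *m vderiv hor_mx x c = c *m vderiv hor_mx x b.
Proof.
move=> Ux b c; rewrite /vderiv.
have -> := derive_hor_mx (row_mx 0 c) Ux; have -> := derive_hor_mx (row_mx 0 b) Ux.
have := fun i p => derive_hess_vertical c i p Ux.
have := fun i p => derive_hess_vertical b i p Ux.
move: ('D_(row_mx 0 b) hess_mx x) ('D_(row_mx 0 c) hess_mx x) => S T SE TE.
rewrite !mulmxA; congr (_ *m eta); apply/rowP => p; rewrite !mxE.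
under eq_bigr do rewrite TE mulr_sumr.
under [RHS]eq_bigr do rewrite SE mulr_sumr.
rewrite exchange_big/=; apply: eq_bigr => i _; apply: eq_bigr => j _.
by rewrite (third_sym12 i j p Ux) mulrCA.
Qed.

(** The matrix is [S *m eta] with [S] symmetric; multiplying by [om] and using that [eta] is skew
    leaves [S - S]. *)
Lemma hor_vderiv_skew x : U x -> forall b : rV,
  vderiv hor_mx x b *m om + om *m (vderiv hor_mx x b)^T = 0.
Proof.
move=> Ux b; rewrite /vderiv; have -> := derive_hor_mx (row_mx 0 b) Ux.
have : ('D_(row_mx 0 b) hess_mx x)^T = 'D_(row_mx 0 b) hess_mx x.
  apply/matrixP => j p; rewrite mxE.
  apply: (etrans (derive_hess_vertical b p j Ux)).
  apply: (etrans _ (esym (derive_hess_vertical b j p Ux))).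
  by apply: eq_bigr => i _; rewrite third_sym23.
move: ('D_(row_mx 0 b) hess_mx x) => S ST.
rewrite trmx_mul ST eta_skew mulNmx mulmxN mulmxA mulmxV// mul1mx.
by rewrite mulmxKV// subrr.
Qed.

Lemma h_fieldE j x : h_field eta W j x = frame hor_mx x 0 (delta_mx 0 j).
Proof.
rewrite /h_field /frame add0r /d_z delta_mx_lshift -rowE.
have -> : \sum_p \sum_q (eta p q * 'D_(dth j) ('D_(dth p) W) x) *: dth q =
    row_mx 0 (row j (hor_mx x)).
  rewrite vertical_sum exchange_big/=; apply: eq_bigr => q _.
  rewrite -scaler_suml; congr (_ *: _); rewrite !mxE; apply: eq_bigr => p _.
  by rewrite mxE mulrC.
by rewrite add_row_mx addr0 add0r.
Qed.

Lemma v_fieldE j x : @v_field R n j x = frame hor_mx x (delta_mx 0 j) 0.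
Proof. by rewrite /v_field /d_theta delta_mx_rshift /frame mul0mx addr0. Qed.

Lemma derive_h_field (f : X -> C) j x : differentiable f x ->
  'D_(h_field eta W j x) f x =
  'D_(dz j) f x + \sum_q (\sum_p eta p q * hess j p x) * 'D_(dth q) f x.
Proof.
move=> df; rewrite /h_field derive_dirD//; congr (_ + _).
rewrite exchange_big/=.
have -> : \sum_q \sum_p (eta p q * 'D_(dth j) ('D_(dth p) W) x) *: dth q =
    \sum_q (\row_q (\sum_p eta p q * hess j p x)) 0 q *: dth q.
  by apply: eq_bigr => q _; rewrite -scaler_suml mxE.
by rewrite derive_sum_dir//; apply: eq_bigr => q _; rewrite mxE.
Qed.

Hypothesis plebanski : forall (i j k : 'I_n) x, U x ->
  'D_(dth k) (fun y => 'D_(dth i) ('D_(dz j) W) y - 'D_(dth j) ('D_(dz i) W) y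
    - \sum_(p < n) \sum_(q < n) eta p q * 'D_(dth i) ('D_(dth p) W) y
        * 'D_(dth j) ('D_(dth q) W) y) x = 0.

(** The [z]-derivative is moved outermost in two exchanges, leaving a Hessian entry inside. *)
Lemma mixed_third i j k x : U x ->
  'D_(dth k) ('D_(dth i) ('D_(dz j) W)) x = 'D_(dz j) (hess i k) x.
Proof.
move=> Ux; have hW1 := holomorphic_derive (dth i) U_open W_hol.
have E1 := derive_eq_open (dth k) U_open
  (fun y Uy => derive_comm (dz j) (dth i) U_open W_hol Uy) Ux.
have E2 := derive_comm (dz j) (dth k) U_open hW1 Ux.
have E3 := derive_eq_open (dz j) U_open (fun y Uy => hess_sym k i Uy) Ux.
exact: (etrans E1 (etrans E2 E3)).
Qed.

Lemma plebanski_expanded i j k x : U x ->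
  'D_(dz j) (hess i k) x - 'D_(dz i) (hess j k) x =
  \sum_p \sum_q eta p q * (third k i p x * hess j q x + hess i p x * third k j q x).
Proof.
move=> Ux; have := plebanski i j k Ux.
have hz a : holomorphic_on U ('D_(dz a) W) := holomorphic_derive _ U_open W_hol.
have h1 a c := holomorphic_derive (dth a) U_open (hz c) Ux.
have dh a c := hess_hol a c Ux.
have d1 p q : differentiable (fun y => eta p q * hess i p y) x.
  exact: (differentiableM (differentiable_cst _ _) (dh i p)).
have d2 p q : differentiable (fun y => eta p q * hess i p y * hess j q y) x.
  exact: (differentiableM (d1 p q) (dh j q)).
have d3 : differentiable (fun y => \sum_p \sum_q eta p q * hess i p y * hess j q y) x.
  by apply: differentiable_sumT => p; exact: differentiable_sumT.
have E1 := deriveB (diff_derivable (v := dth k) (differentiableB (h1 i j) (h1 j i)))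
  (diff_derivable (v := dth k) d3).
have E2 := deriveB (diff_derivable (v := dth k) (h1 i j)) (diff_derivable (v := dth k) (h1 j i)).
move=> E0; have {E0} E1 := etrans (esym E1) E0.
have {E2} E2 := etrans E2 (congr2 (fun a b => a - b) (mixed_third i j k Ux) (mixed_third j i k Ux)).
move: E1 => /eqP; rewrite subr_eq0 => /eqP E1.
have E3 := etrans (esym E2) E1; apply: (etrans E3).
have -> := derive_sumT (dth k) (fun p => differentiable_sumT (d2 p)).
apply: eq_bigr => p _; have -> := derive_sumT (dth k) (d2 p).
apply: eq_bigr => q _.
have F1 := deriveM (diff_derivable (v := dth k) (d1 p q)) (diff_derivable (v := dth k) (dh j q)).
have F2 := deriveZ (eta p q) (diff_derivable (v := dth k) (dh i p)).
have F3 (e t1 t2 k1 k2 : C) :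
    (e * k1) *: t2 + k2 *: (e *: t1) = e * (t1 * k2 + k1 * t2).
  by rewrite /GRing.scale/=; ring.
have F4 : 'D_(dth k) (fun y => eta p q * hess i p y) x = eta p q *: third k i p x := F2.
apply: (etrans F1).
have F5 := congr1 (fun z => (eta p q * hess i p x) *: third k j q x + hess j q x *: z) F4.
exact: (etrans F5 (F3 _ _ _ _ _)).
Qed.

(** Pure index algebra: of the two product terms, one matches by symmetry of [T] alone, while the
    other needs [p] and [q] exchanged and takes its sign from the skewness of [eta]. *)
Lemma plebanski_contraction (H : 'I_n -> 'I_n -> C) (T : 'I_n -> 'I_n -> 'I_n -> C)
    (i j k : 'I_n) (a b : C) :
  (forall p q r, T p q r = T q p r) -> (forall p q r, T p q r = T p r q) ->
  a - b = \sum_p \sum_q eta p q * (T k i p * H j q + H i p * T k j q) ->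
  b + \sum_q (\sum_p eta p q * H i p) * T q j k =
  a + \sum_q (\sum_p eta p q * H j p) * T q i k.
Proof.
move=> T12 T23.
under eq_bigr do under eq_bigr do rewrite mulrDr.
under eq_bigr do rewrite big_split/=.
rewrite big_split/= => E.
have -> : \sum_q (\sum_p eta p q * H i p) * T q j k =
    \sum_p \sum_q eta p q * (H i p * T k j q).
  under eq_bigr do rewrite mulr_suml.
  rewrite exchange_big/=; apply: eq_bigr => p _; apply: eq_bigr => q _.
  by rewrite -mulrA (T23 q j k) (T12 q k j) (T23 k q j).
have -> : \sum_q (\sum_p eta p q * H j p) * T q i k =
    - \sum_p \sum_q eta p q * (T k i p * H j q).
  under eq_bigr do rewrite mulr_suml.
  rewrite -sumrN; apply: eq_bigr => q _; rewrite -sumrN; apply: eq_bigr => p _.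
  by rewrite (T23 q i k) (T12 q k i) (T23 k q i) (eta_skew_entry p q); ring.
by rewrite -[a](subrK b) E; ring.
Qed.

(** This is [[h_i, h_j] = 0] before contraction with the constant matrix [eta]. *)
Lemma derive_h_hess i j k x : U x ->
  'D_(h_field eta W i x) (hess j k) x = 'D_(h_field eta W j x) (hess i k) x.
Proof.
move=> Ux.
apply: (etrans (derive_h_field i (hess_hol j k Ux))).
apply: (etrans _ (esym (derive_h_field j (hess_hol i k Ux)))).
apply: (plebanski_contraction (H := fun p q => hess p q x)
  (T := fun p q r => third p q r x)).
- by move=> p q r; exact: third_sym12.
- by move=> p q r; exact: third_sym23.
- exact: plebanski_expanded.
Qed.

Lemma frame_horizontal_sum x (c : rV) :
  frame hor_mx x 0 c = \sum_i c 0 i *: h_field eta W i x.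
Proof.
rewrite [in LHS](row_sum_delta c); elim/big_rec2: _ => [|i y z _ <-].
  exact: frame0.
by rewrite h_fieldE -frameP scaler0 add0r.
Qed.

Lemma hor_flat x : U x -> forall b c : rV,
  b *m 'D_(frame hor_mx x 0 c) hor_mx x = c *m 'D_(frame hor_mx x 0 b) hor_mx x.
Proof.
move=> Ux b c.
have -> := derive_hor_mx (frame hor_mx x 0 c) Ux.
have -> := derive_hor_mx (frame hor_mx x 0 b) Ux.
have E (e : rV) j p : 'D_(frame hor_mx x 0 e) hess_mx x j p =
    \sum_i e 0 i * 'D_(h_field eta W i x) (hess j p) x.
  apply: (etrans (derive_hess_mx (frame hor_mx x 0 e) j p Ux)).
  have -> := frame_horizontal_sum x e.
  exact: derive_sum_dir (hess_hol j p Ux).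
have Eb := E b; have Ec := E c; clear E.
move: ('D_(frame hor_mx x 0 b) hess_mx x) Eb => S SE.
move: ('D_(frame hor_mx x 0 c) hess_mx x) Ec => T TE.
rewrite !mulmxA; congr (_ *m eta); apply/rowP => p; rewrite !mxE.
under eq_bigr do rewrite TE mulr_sumr.
under [RHS]eq_bigr do rewrite SE mulr_sumr.
rewrite exchange_big/=; apply: eq_bigr => i _; apply: eq_bigr => j _.
apply: (etrans (mulrCA _ _ _)).
exact: (congr1 (fun z => c 0 i * (b 0 j * z)) (derive_h_hess i j p Ux)).
Qed.

End Plebanski.

(** * The hyperkahler structure *)

Section Hyperkahler.
Context (R : realType) (n : nat).
Local Notation C := R[i].
Local Notation X := 'rV[C]_(n + n).
Local Notation rV := 'rV[C]_n.
Variables (om : 'M[C]_n) (U : set X) (N : X -> 'M[C]_n).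
Hypotheses (om_skew : om^T = - om) (om_unit : om \in unitmx).
Hypotheses (U_open : open U) (N_hol : holomorphic_on U N).
Hypothesis N_sym : forall x, U x -> forall b c : rV,
  b *m vderiv N x c = c *m vderiv N x b.
Hypothesis N_flat : forall x, U x -> forall b c : rV,
  b *m 'D_(frame N x 0 c) N x = c *m 'D_(frame N x 0 b) N x.
Hypothesis N_skew : forall x, U x -> forall b : rV,
  vderiv N x b *m om + om *m (vderiv N x b)^T = 0.
Variables (g : bilinear_field R (n + n)) (I J K : endo_field R (n + n)).
Hypothesis gE : forall x, U x -> forall a c, g x a c = std_metric N om x a c.
Hypothesis IE : forall x, U x -> forall a, I x a = std_I N x a.
Hypothesis JE : forall x, U x -> forall a, J x a = std_J N x a.
Hypothesis KE : forall x, U x -> forall a, K x a = std_K N x a.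

Lemma holomorphic_std_endo (al be : X -> X -> rV) (E : endo_field R (n + n)) :
  (forall x, U x -> forall a, E x a = frame N x (al x a) (be x a)) ->
  (forall x, U x -> linear (E x)) ->
  (forall a, holomorphic_on U (al^~ a)) -> (forall a, holomorphic_on U (be^~ a)) ->
  holomorphic_endo U E.
Proof.
move=> EE lE hal hbe; split=> // a.
apply: (holomorphic_on_eq U_open (fun x Ux => esym (EE x Ux a))) => x Ux.
exact: (differentiable_frame N_hol Ux (hal a x Ux) (hbe a x Ux)).
Qed.

Lemma linear_eq (V W : lmodType C) (f h : V -> W) : f =1 h -> linear h -> linear f.
Proof. by move=> /funext ->. Qed.

Let cst_hol (a : X) : holomorphic_on U (fun=> a).
Proof. by move=> x _; exact: differentiable_cst. Qed.

Let hol_lsub (a : X) : holomorphic_on U (fun=> lsubmx a : rV).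
Proof. by move=> x _; exact: differentiable_cst. Qed.

Let hol_vert (a : X) : holomorphic_on U (fun x => vert N x a).
Proof. exact: (holomorphic_vert N_hol (cst_hol a)). Qed.

Let hol_scale (k : C) (A : X -> rV) : holomorphic_on U A ->
  holomorphic_on U (fun x => k *: A x).
Proof. by move=> hA x Ux; exact: (differentiableZ k (hA x Ux)). Qed.

Let hol_opp (A : X -> rV) : holomorphic_on U A -> holomorphic_on U (fun x => - A x).
Proof. by move=> hA x Ux; exact: (differentiableN (hA x Ux)). Qed.

(** [E] and [S] agree only on [U], so the fields they produce are different total functions; the
    connection sees them only through their value and derivative at a point of the open set [U]. *)
Lemma endo_parallel (E S : endo_field R (n + n)) :
  (forall x, U x -> forall a, E x a = S x a) ->
  (forall u w x, holomorphic_on U w -> U x ->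
     connection N u (fun y => S y (w y)) x = S x (connection N u w x)) ->
  covariantly_constant U (connection N) E.
Proof.
move=> ES par u w hu hw x Ux; have P := par u w x hw Ux.
apply: (etrans _ (etrans P (esym (ES x Ux _)))).
have E0 y : U y -> E y (w y) = S y (w y) by move=> Uy; exact: ES.
have E1 := derive_eq_open (u x) U_open
  (fun y Uy => congr1 (vert N y) (E0 y Uy)) Ux.
have E2 := derive_eq_open (u x) U_open
  (fun y Uy => congr1 (lsubmx : X -> rV) (E0 y Uy)) Ux.
have E3 := congr1 (vert N x) (E0 x Ux).
have E4 := congr1 (lsubmx : X -> rV) (E0 x Ux).
exact: (congr2 (frame N x)
  (congr2 (fun a b => a - b *m vderiv N x (lsubmx (u x))) E1 E3)
  (congr2 (fun a b => a - b *m vderiv N x (lsubmx (u x))) E2 E4)).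
Qed.

Lemma std_levi_civita : levi_civita U g (connection N).
Proof.
split.
- exact: (connection_is_holomorphic U_open N_hol).
- by move=> u w hu hw x Ux; exact: (connection_torsion_free N_hol N_sym N_flat).
- move=> u w1 w2 hu h1 h2 x Ux.
  have E := connection_metric N_hol N_skew u h1 h2 Ux.
  have E0 := derive_eq_open (u x) U_open (fun y Uy => gE Uy (w1 y) (w2 y)) Ux.
  apply: (etrans E0); apply: (etrans E).
  exact: (congr2 +%R (esym (gE Ux _ _)) (esym (gE Ux _ _))).
Qed.

Lemma std_hyperkahler : complex_hyperkahler U g I J K.
Proof.
have gb : bilinear_on U g.
  move=> x Ux; have [b1 b2] := @std_metric_bilinear R n N om U x Ux; split=> a.
    by move=> k c e; rewrite !gE//; exact: b1.
  by move=> k c e; rewrite !gE//; exact: b2.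
split.
- split=> // a c; apply: (holomorphic_on_eq U_open (fun x Ux => esym (gE Ux a c))).
  move=> x Ux; have [+ _] := std_metric_diffE om N_hol (w1 := fun=> a) (w2 := fun=> c) 0 Ux
    (differentiable_cst _ _) (differentiable_cst _ _).
  exact.
- by move=> x Ux a c; rewrite !gE// std_metric_sym.
- move=> x Ux a ga; apply: (std_metric_nondegenerate om_skew om_unit (N := N) (x := x)).
  by move=> c; rewrite -gE.
- apply: (holomorphic_std_endo IE).
  + by move=> x Ux; apply: linear_eq (IE Ux) _; exact: std_I_linear.
  + by move=> a; apply: hol_scale; exact: hol_vert.
  + by move=> a; apply: hol_scale; exact: hol_lsub.
- apply: (holomorphic_std_endo JE).
  + by move=> x Ux; apply: linear_eq (JE Ux) _; exact: std_J_linear.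
  + by move=> a; apply: hol_opp; exact: hol_lsub.
  + by move=> a; exact: hol_vert.
- apply: (holomorphic_std_endo KE).
  + by move=> x Ux; apply: linear_eq (KE Ux) _; exact: std_K_linear.
  + by move=> a; apply: hol_scale; exact: hol_lsub.
  + by move=> a; apply: hol_scale; exact: hol_vert.
- by move=> x Ux a; rewrite !IE//; exact: std_II.
- by move=> x Ux a; rewrite !JE//; exact: std_JJ.
- by move=> x Ux a; rewrite !KE//; exact: std_KK.
- by move=> x Ux a; rewrite IE// JE// KE//; exact: std_IJK.
- by move=> x Ux a c; rewrite !gE// !IE//; exact: std_metric_I.
- by move=> x Ux a c; rewrite !gE// !JE//; exact: std_metric_J.
- by move=> x Ux a c; rewrite !gE// !KE//; exact: std_metric_K.
- exists (connection N); first exact: std_levi_civita.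
  split.
  + by apply: endo_parallel IE _ => u w x; exact: (connection_std_I N_hol).
  + by apply: endo_parallel JE _ => u w x; exact: (connection_std_J N_hol).
  + by apply: endo_parallel KE _ => u w x; exact: (connection_std_K N_hol).
Qed.

Lemma base_form_symplectic : holomorphic_symplectic [set: rV] (base_form om).
Proof.
split.
- split.
    move=> x _; split=> a k c e; rewrite !base_formE//.
      by rewrite pairingDr pairingZr; ring.
    by rewrite pairingDl pairingZl; ring.
  by move=> a c x _; exact: differentiable_cst.
- by move=> x _ a; rewrite /base_form !big1// => p _; rewrite big1// => q _;
    rewrite /wedge_dz [a 0 p * _]mulrC; ring.
- move=> x _ a ba; apply: (pairing_nondegenerate om_unit) => c.
  have /eqP := ba c; rewrite base_formE// mulf_eq0 => /orP[|/eqP//].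
  by rewrite pnatr_eq0.
(* The form has constant coefficients, so each of the three derivatives vanishes. *)
- move=> x _ a c e.
  have D (b : rV) (k : C) : 'D_b (fun _ : rV => k) x = 0 by exact: derive_cst.
  by rewrite /base_form !D !addr0.
Qed.

Lemma differentiable_tangent_proj x : differentiable (@tangent_proj R n) x.
Proof. exact: (differentiable_lsub (u := id)). Qed.

Lemma diff_tangent_proj x a : 'd (@tangent_proj R n) x a = lsubmx a.
Proof.
have c : continuous (lsubmx : X -> rV).
  by move=> y; exact: differentiable_continuous (differentiable_tangent_proj y).
exact: (congr1 (fun f : X -> rV => f a) (diff_lin x c)).
Qed.

Lemma std_fibration : affine_symplectic_fibration U g I J K [set: rV]
  (@tangent_proj R n) (base_form om).
Proof.
split=> //.
- exact: std_hyperkahler.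
- by move=> x _; exact: differentiable_tangent_proj.
- exact: base_form_symplectic.
- move=> x Ux a c; rewrite /pullback_form base_formE// !diff_tangent_proj.
  rewrite -(@std_Omega_minus R n N om om_skew x a c) /Omega_minus /Omega_of.
  have SJ := congr1 (std_metric N om x a) (JE Ux c).
  have SK := congr1 (std_metric N om x a) (KE Ux c).
  exact: (congr2 (fun y z => y - 'i%C * z)
    (etrans (gE Ux a (J x c)) SJ) (etrans (gE Ux a (K x c)) SK)).
Qed.

End Hyperkahler.

Theorem mainTheorem1 (R : realType) (n : nat) (n_ge2 : (2 <= n)%N)
    (n_even : ~~ odd n)
    (om : 'M[R[i]]_n) (om_skew : om^T = - om) (om_nondeg : om \in unitmx)
    (X0 : set 'rV[R[i]]_(n + n)) (X0_open : open X0)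
    (W : 'rV[R[i]]_(n + n) -> R[i]) (W_holomorphic : holomorphic_on X0 W)
    (plebanski : forall (i j k : 'I_n) (x : 'rV[R[i]]_(n + n)), X0 x ->
      'D_(d_theta R k) (fun y : 'rV[R[i]]_(n + n) =>
         'D_(d_theta R i) ('D_(d_z R j) W) y
         - 'D_(d_theta R j) ('D_(d_z R i) W) y
         - \sum_(p < n) \sum_(q < n) invmx om p q
             * 'D_(d_theta R i) ('D_(d_theta R p) W) y
             * 'D_(d_theta R j) ('D_(d_theta R q) W) y) x = 0) :
  let v : 'I_n -> vector_field R (n + n) := @v_field R n in
  let h : 'I_n -> vector_field R (n + n) := h_field (invmx om) W in
  [/\ forall j : 'I_n, holomorphic_on X0 (v j) /\ holomorphic_on X0 (h j),
      forall x : 'rV[R[i]]_(n + n), X0 x ->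
        basis_of fullv ([seq v j x | j <- enum 'I_n]
                        ++ [seq h j x | j <- enum 'I_n]),
      exists (g : bilinear_field R (n + n)) (I J K : endo_field R (n + n)),
        metric_table X0 om v h g /\ quaternion_table X0 v h I J K
    & forall (g : bilinear_field R (n + n)) (I J K : endo_field R (n + n)),
        metric_table X0 om v h g -> quaternion_table X0 v h I J K ->
        complex_hyperkahler X0 g I J K
        /\ affine_symplectic_fibration X0 g I J K
             [set: 'rV[R[i]]_n] (@tangent_proj R n) (base_form om)].
Proof.
move=> v h; pose N := hor_mx om W.
have vE j x : v j x = frame N x (delta_mx 0 j) 0 by exact: v_fieldE.
have hE j x : h j x = frame N x 0 (delta_mx 0 j) by exact: h_fieldE.
have N_hol : holomorphic_on X0 N := hor_mx_hol om X0_open W_holomorphic.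
have hol_frame (a c : 'rV[R[i]]_n) : holomorphic_on X0 (fun x => frame N x a c).
  by move=> x Ux; exact: (differentiable_frame N_hol Ux (differentiable_cst _ _) (differentiable_cst _ _)).
split.
- move=> j; split.
    exact: (holomorphic_on_eq X0_open (fun x _ => esym (vE j x)) (hol_frame _ _)).
  exact: (holomorphic_on_eq X0_open (fun x _ => esym (hE j x)) (hol_frame _ _)).
- by move=> x _; exact: frame_basis.
- exists (std_metric N om), (std_I N), (std_J N), (std_K N); split.
    exact: std_metric_table.
  exact: std_quaternion_table.
move=> g I J K gt qt.
(* Any tensors satisfying the tables coincide on [X0] with the explicit ones, for which everything
   has been established. *)
have gE x (Ux : X0 x) := metric_table_std vE hE gt Ux.
have qE x (Ux : X0 x) := quaternion_table_std vE hE qt Ux.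
have IE x (Ux : X0 x) : forall a, I x a = std_I N x a.
  by have [H _ _] := qE x Ux; exact: H.
have JE x (Ux : X0 x) : forall a, J x a = std_J N x a.
  by have [_ H _] := qE x Ux; exact: H.
have KE x (Ux : X0 x) : forall a, K x a = std_K N x a.
  by have [_ _ H] := qE x Ux; exact: H.
have N_sym x (Ux : X0 x) := hor_vderiv_sym om X0_open W_holomorphic Ux.
have N_skew x (Ux : X0 x) :=
  hor_vderiv_skew om_skew om_nondeg X0_open W_holomorphic Ux.
have N_flat x (Ux : X0 x) :=
  hor_flat om_skew om_nondeg X0_open W_holomorphic plebanski Ux.
split.
  exact: (std_hyperkahler om_skew om_nondeg X0_open N_hol N_sym N_flat N_skew gE IE JE KE).
exact: (std_fibration om_skew om_nondeg X0_open N_hol N_sym N_flat N_skew gE IE JE KE).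
Qed.
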